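(* Let $n\ge1$. For $N\in\mathbb{N}$ let $a_N=(\lfloor N/2\rfloor,0,\dots,0)\in\mathbb{N}^n$, and let $e_{a_N}=e_{N,a_N}$ be the corresponding element of the orthonormal basis of the quantum space $\mathcal{H}_N$ of the complex projective space $\mathbb{CP}^n$. For every $p\in[2,+\infty]$ there exists a constant $C=C(n,p)>0$, uniformly bounded with respect to $p$, such that $$\|e_{a_N}\|_{L^p(\mathbb{CP}^n)}\underset{N\to\infty}{\sim}C\,N^{\left(n-\frac12\right)\left(\frac12-\frac1p\right)}.$$
   Context: On the chart $\{z_0\ne0\}$ of $\mathbb{CP}^n$ use the coordinates $w=(w_1,\dots,w_n)=(z_1/z_0,\dots,z_n/z_0)\in\mathbb{C}^n$ (the complement has measure zero). Write $|w|^2=\sum_j|w_j|^2$, $\langle w\rangle=\sqrt{1+|w|^2}$, $\tilde w=(1,\overline{w_1},\dots,\overline{w_n})\in\mathbb{C}^{n+1}$. $\mathbb{CP}^n$ is endowed with the Fubini-Study form $$\omega=\frac{i}{(1+|w|^2)^2}\sum_{1\le l,m\le n}\left((1+|w|^2)\delta_{l,m}-\overline{w_l}w_m\right)dw_l\wedge d\overline{w_m},$$ whose volume form $\omega^n/n!$ is $\frac{2^n}{\langle w\rangle^{2(n+1)}}dw$, with $dw$ Lebesgue measure on $\mathbb{C}^n$. With prequantum bundle $\mathcal{O}(1)$ (the dual of the tautological bundle), the quantum space $\mathcal{H}_N$ of holomorphic sections of $\mathcal{O}(1)^{\otimes N}$ is described in these coordinates as $$\mathcal{H}_N=\left\{\frac{Q(w)\,\tilde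 w^{\otimes N}}{\langle w\rangle^{2N}} : Q\in\mathbb{C}[X_1,\dots,X_n],\ \deg Q\le N\right\}\subset L^2\left(\mathbb{C}^n,(\mathbb{C}^{n+1})^{\otimes N},\tfrac{2^n}{\langle w\rangle^{2(n+1)}}dw\right),$$ and it has the orthonormal basis, indexed by $a\in\mathbb{N}^n$ with $|a|=\sum_j a_j\le N$, $$e_{N,a}(w)=\sqrt{\frac{(N+n)\cdots(N+1)}{(2\pi)^n}\binom Na}\ \frac{w^a\,\tilde w^{\otimes N}}{\langle w\rangle^{2N}},\qquad \binom Na=\frac{N!}{a_1!\cdots a_n!(N-|a|)!}.$$ $L^p(\mathbb{CP}^n)$ norms are taken with the pointwise Hermitian norm on $(\mathbb{C}^{n+1})^{\otimes N}$ (so that $|\tilde w^{\otimes N}|=\langle w\rangle^N$) and the measure $\frac{2^n}{\langle w\rangle^{2(n+1)}}dw$; the $L^\infty$ norm is the supremum of the pointwise norm. $A_N\sim B_N$ means $A_N/B_N\to1$; the convention $1/p=0$ for $p=\infty$ is used. *)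

(* Defs.v *)
From HB Require Import structures.
From mathcomp Require Import all_boot all_order all_algebra complex.
From mathcomp Require Import all_classical all_reals all_analysis.
From mathcomp Require Import measurable_realfun.

Set Implicit Arguments.
Unset Strict Implicit.
Unset Printing Implicit Defensive.
Import Order.TTheory GRing.Theory Num.Theory.
Import numFieldNormedType.Exports.
Import ComplexField.Normc.
Local Open Scope classical_set_scope.
Local Open Scope ring_scope.
Local Open Scope complex_scope.

(* The product measure, re-declared so that its sigma-finiteness can be found by
   unification: on [_ \x _] itself the instance for subprobabilities is found
   first. *)
Section product_sigma_finite.
Context d1 d2 (T1 : measurableType d1) (T2 : measurableType d2) (R : realType).
Variables (mu : {sigma_finite_measure set T1 -> \bar R})
  (nu : {sigma_finite_measure set T2 -> \bar R}).

Definition product_sigma_finite : set (T1 * T2) -> \bar R := (mu \x nu)%E.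

HB.instance Definition _ := Measure.on product_sigma_finite.

Let product_sigma_finiteT : sigma_finite setT product_sigma_finite.
Proof.
have /sigma_finiteP[F [TF ndF Foo]] := sigma_finiteT mu.
have /sigma_finiteP[G [TG ndG Goo]] := sigma_finiteT nu.
exists (fun k => F k `*` G k).
  rewrite -setXTT TF TG; apply/seteqP; split => [[x y]|[x y] [k _ []/= ? ?]].
    move=> [/= [k _ Fx] [l _ Gy]]; exists (maxn k l) => //; split => /=.
    - by move: x Fx; apply/subsetPset/ndF/leq_maxl.
    - by move: y Gy; apply/subsetPset/ndG/leq_maxr.
  by split; exists k.
move=> k; have [? ?] := Foo k; have [? ?] := Goo k; split.
  exact: measurableX.
by rewrite /product_sigma_finite product_measure1E// lte_mul_pinfty//
  ge0_fin_numE.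
Qed.

HB.instance Definition _ := Measure_isSigmaFinite.Build _ _ _
  product_sigma_finite product_sigma_finiteT.

End product_sigma_finite.

Section tuple_measure.
Context d (T : measurableType d) (R : realType).

Definition cons_pair n (x : T * n.-tuple T) : n.+1.-tuple T :=
  [the n.+1.-tuple T of x.1 :: x.2].

Lemma measurable_cons_pair n : measurable_fun setT (@cons_pair n).
Proof. exact: measurable_cons. Qed.

Section cons_measure.
Variables (mu : {sigma_finite_measure set T -> \bar R}) (n : nat)
  (nu : {sigma_finite_measure set (n.-tuple T) -> \bar R}).

Definition cons_measure : set (n.+1.-tuple T) -> \bar R :=
  pushforward (product_sigma_finite mu nu) (@cons_pair n).

HB.instance Definition _ := Measure.copy cons_measure
  (measure_function_pushforward__canonical__measure_function_Measure
     (product_sigma_finite mu nu) (@measurable_cons_pair n)).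

Let cons_measure_sigma_finite : sigma_finite setT cons_measure.
Proof.
have [F TF Foo] := sigma_finiteT (product_sigma_finite mu nu).
pose unc (t : n.+1.-tuple T) := (tnth t ord0, [tuple of behead t]).
have munc : measurable_fun setT unc.
  apply/measurable_fun_pairP; split.
    exact: (measurable_tnth (ord0 : 'I_n.+1)).
  exact: measurable_behead.
have cK : cancel (@cons_pair n) unc.
  by move=> [x t]; congr pair; apply/val_inj.
exists (fun k => unc @^-1` F k).
  by rewrite -preimage_bigcup -TF preimage_setT.
move=> k; have [mF Fk] := Foo k; split.
  by rewrite -[X in measurable X]setTI; exact: munc.
rewrite /cons_measure /pushforward -comp_preimage.
by rewrite (_ : unc \o _ = id)//; apply/funext => x /=; rewrite cK.
Qed.

HB.instance Definition _ :=
  Measure_isSigmaFinite.Build _ _ _ cons_measure cons_measure_sigma_finite.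

End cons_measure.

Fixpoint tuple_measure (mu : {sigma_finite_measure set T -> \bar R}) (n : nat) :
    {sigma_finite_measure set (n.-tuple T) -> \bar R} :=
  match n with
  | 0%N => \d_([tuple] : 0.-tuple T)
  | m.+1 => cons_measure mu (tuple_measure mu m)
  end.

End tuple_measure.

(* A point x + iy of the complex line is represented by the pair (x, y), so
   that the Lebesgue measure dw on C^n is the 2n-fold product of the Lebesgue
   measure on the reals. *)
Notation plane R := (measurableTypeR R * measurableTypeR R)%type.
Notation Cspace R n := (n.-tuple (plane R)).

Definition lebesgue_Cspace (R : realType) (n : nat) :
    {sigma_finite_measure set (Cspace R n) -> \bar R} :=
  tuple_measure
    (product_sigma_finite (@lebesgue_measure R) (@lebesgue_measure R)) n.

Section projective_space.
Context (R : realType) (n : nat).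
Implicit Types (w : Cspace R n) (p : \bar R).

Definition chart_coord w (j : 'I_n) : R[i] := (tnth w j).1 +i* (tnth w j).2.

Definition bracket w : R :=
  Num.sqrt (1 + \sum_(j < n) normc (chart_coord w j) ^+ 2).

Definition wtilde w (k : 'I_n.+1) : R[i] :=
  if unlift ord0 k is Some j then (chart_coord w j)^* else 1.

Definition fubini_study_density w : R := 2 ^+ n / bracket w ^+ (2 * n.+1).

Lemma measurable_fubini_study_density :
  measurable_fun setT fubini_study_density.
Proof.
have mcoord (pr : plane R -> R) (j : 'I_n) :
    measurable_fun setT pr -> measurable_fun setT (fun w => pr (tnth w j)).
  by move=> mpr; apply: (measurableT_comp mpr); exact: measurable_tnth.
have -> : fubini_study_density =
    (fun w => 2 ^+ n * bracket w `^ (- (2 * n.+1)%:R)).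
  by apply/funext => w; rewrite powRN powR_mulrn ?sqrtr_ge0.
apply: measurable_funM; first exact: measurable_cst.
apply: (measurableT_comp (measurable_powR _)).
apply: (measurableT_comp (continuous_measurable_fun (@sqrt_continuous R))).
apply: measurable_funD; first exact: measurable_cst.
apply: measurable_sum => j; apply: measurable_funX.
apply: (measurableT_comp (continuous_measurable_fun (@sqrt_continuous R))).
apply: measurable_funD; apply: measurable_funX.
  exact: (mcoord fst).
exact: (mcoord snd).
Qed.

Lemma fubini_study_density_ge0 w : 0 <= fubini_study_density w.
Proof. by rewrite divr_ge0// exprn_ge0// sqrtr_ge0. Qed.

Definition fubini_study (A : set (Cspace R n)) : \bar R :=
  (\int[lebesgue_Cspace R n]_(w in A) (fubini_study_density w)%:E)%E.

Let fubini_study0 : fubini_study set0 = 0%E.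
Proof. by rewrite /fubini_study integral_set0. Qed.

Let fubini_study_ge0 A : (0 <= fubini_study A)%E.
Proof.
by apply: integral_ge0 => w _; rewrite lee_fin fubini_study_density_ge0.
Qed.

Let fubini_study_sigma_additive : semi_sigma_additive fubini_study.
Proof.
move=> /= A mA tA mUA; rewrite /fubini_study ge0_integral_bigcup//=.
- apply: is_cvg_ereal_nneg_natsum_cond => k _ _.
  exact: fubini_study_ge0.
- apply/measurable_funTS/measurable_EFinP.
  exact: measurable_fubini_study_density.
- by move=> w _; rewrite lee_fin fubini_study_density_ge0.
Qed.

HB.instance Definition _ := isMeasure.Build _ _ _ fubini_study
  fubini_study0 fubini_study_ge0 fubini_study_sigma_additive.

(* The tensor power (C^{n+1})^{(x)N}, in the coordinates given by the basis
   e_{t_1} (x) ... (x) e_{t_N}, orthonormal for the induced Hermitian product. *)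
Definition tensor (N : nat) := {ffun N.-tuple 'I_n.+1 -> R[i]}.

Definition tensor_power (N : nat) (v : 'I_n.+1 -> R[i]) : tensor N :=
  [ffun t => \prod_(k < N) v (tnth t k)].

Definition tensor_norm (N : nat) (T : tensor N) : R :=
  Num.sqrt (\sum_t normc (T t) ^+ 2).

(* Essential and pointwise suprema agree on the continuous sections to which
   this is applied; [Lnorm] at [+oo] is the former. *)
Definition Lp_norm (N : nat) p (u : Cspace R n -> tensor N) : \bar R :=
  if p == +oo%E then ereal_sup (range (fun w => (tensor_norm (u w))%:E))
  else Lnorm fubini_study p (fun w => (tensor_norm (u w))%:E).

Definition multinomial (N : nat) (a : 'I_n -> nat) : R :=
  N`!%:R / ((\prod_(j < n) (a j)`!)%N%:R * (N - \sum_(j < n) a j)%N`!%:R).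

Definition basis_section (N : nat) (a : 'I_n -> nat) (w : Cspace R n) :
    tensor N :=
  ((Num.sqrt ((\prod_(1 <= k < n.+1) (N + k)%N%:R) / (2 * pi) ^+ n
              * multinomial N a))%:C
   * (\prod_(j < n) chart_coord w j ^+ a j) / (bracket w ^+ (2 * N))%:C)
  *: tensor_power N (wtilde w).

Definition half_exponent (N : nat) (j : 'I_n) : nat :=
  if j == 0 :> nat then N./2 else 0.

End projective_space.

(* Main.v *)
(* The pointwise norm of e_{a_N} is sqrt(c_N) |w_1|^k / <w>^N with
   k = floor(N/2), so everything reduces to the variable r = |w_1|^2.
   Integrating out w_2, ..., w_n one complex line at a time, and substituting
   t = r / (1 + r), the p-th power of the L^p norm becomes an explicit rational
   factor in N times the beta integral of t^(kp/2) (1 - t)^((N - k)p/2) over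
   [0, 1]; Laplace's method at t = 1/2 gives that integral the order
   2^(-Np/2) N^(-1/2).  The case p = 2, where the beta integral is known in
   closed form, yields the asymptotics of the central binomial coefficient in
   c_N.  For p = oo the supremum of r^k / (1 + r)^N is squeezed between its
   value 2^(-N) at r = 1 and 2^(-N) e^(1/(4k)).
   The passage to polar coordinates only uses that the disc of radius sqrt t
   has area proportional to t: the area of the unit disc is absorbed in the
   constant and never computed. *)

Require Import Defs.
From mathcomp Require Import all_boot all_order all_algebra complex.
From mathcomp Require Import all_classical all_reals all_analysis.
From mathcomp Require Import measurable_realfun zify ring lra.
Set Implicit Arguments.
Unset Strict Implicit.
Unset Printing Implicit Defensive.
Import Order.TTheory GRing.Theory Num.Theory.
Import numFieldNormedType.Exports.
Import ComplexField.Normc.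
Local Open Scope classical_set_scope.
Local Open Scope ring_scope.

(** * Integration tools *)

Section affine_substitution.
Context {R : realType}.
Local Notation mu := (@lebesgue_measure R).
Implicit Types (c d : R).

Let affine c d : measurableTypeR R -> measurableTypeR R := fun x => c * x + d.

Let measurable_affine c d : measurable_fun [set: measurableTypeR R] (affine c d).
Proof.
apply: measurable_funD; last exact: measurable_cst.
by apply: measurable_funM; [exact: measurable_cst|exact: measurable_id].
Qed.

(** Uniqueness of Lebesgue measure: the pushforward under x -> c x + d, scaled by c, gives every
    half-open interval its length. *)
Lemma lebesgue_measure_affine c d (A : set (measurableTypeR R)) :
  0 < c -> measurable A ->
  mu A = (c%:E * mu ((fun x => c * x + d)%R @^-1` A))%E.
Proof.
move=> c0 mA.
pose nu : {measure set (measurableTypeR R) -> \bar R} :=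
  mscale (NngNum (ltW c0))
    (measure_function_pushforward__canonical__measure_function_Measure
      mu (measurable_affine c d)).
apply: (lebesgue_measure_unique (mu := nu)) => // _ [[a b]] _ <-.
rewrite /nu /= /mscale /= /pushforward.
have -> : affine c d @^-1` `]a, b] = `](a - d) / c, (b - d) / c]%classic.
  apply/seteqP; split => x /=; rewrite /affine !in_itv/=;
    by rewrite ltr_pdivrMr// ler_pdivlMr// ltrBlDr lerBrDr [x * c]mulrC.
rewrite !lebesgue_measure_itv/= !lte_fin ltr_pM2r ?invr_gt0// ltrD2r.
case: ifP => _; last by rewrite mule0.
rewrite -!EFinD -EFinM; congr EFin; field.
by rewrite gt_eqF.
Qed.

Lemma ge0_integral_affine c d (f : R -> \bar R) : 0 < c ->
  measurable_fun setT f -> (forall x, (0 <= f x)%E) ->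
  (\int[mu]_x f x = c%:E * \int[mu]_x f (c * x + d)%R)%E.
Proof.
move=> c0 mf f0.
pose nu : {measure set (measurableTypeR R) -> \bar R} :=
    (measure_function_pushforward__canonical__measure_function_Measure
      mu (measurable_affine c d)).
transitivity (\int[mscale (NngNum (ltW c0)) nu]_x f x)%E.
  by apply: eq_measure_integral => A mA _; exact: lebesgue_measure_affine.
rewrite ge0_integral_mscale//.
by rewrite [X in (_ * X)%E](ge0_integral_pushforward (measurable_affine c d)).
Qed.

End affine_substitution.

Section density.
Local Open Scope ereal_scope.
Context d (T : measurableType d) (R : realType).
Variables (mu nu : {measure set T -> \bar R}) (g : T -> R).
Hypotheses (mg : measurable_fun setT g) (g0 : forall x, (0 <= g x)%R).
Hypothesis nuE : forall A, measurable A -> nu A = \int[mu]_(x in A) (g x)%:E.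

Import HBNNSimple.

(** Linearity over the level sets of a simple function, then monotone convergence. The density
    relation is assumed on sets, which fits both [fubini_study] and Lebesgue measure restricted to a
    half-line. *)
Lemma ge0_integral_density (f : T -> \bar R) :
  measurable_fun setT f -> (forall x, 0 <= f x) ->
  \int[nu]_x f x = \int[mu]_x (f x * (g x)%:E).
Proof.
move=> mf f0; pose h := nnsfun_approx measurableT mf.
have hf x : (h n x)%:E @[n --> \oo] --> f x by exact: cvg_nnsfun_approx.
have ndh x : {homo (fun n => (h n x)%:E) : a b / (a <= b)%N >-> a <= b}.
  by move=> a b ab; rewrite lee_fin; exact/lefP/nd_nnsfun_approx.
have mgE : measurable_fun setT (EFin \o g) by exact/measurable_EFinP.
have mhE n : measurable_fun setT (fun x => (h n x)%:E).
  exact/measurable_EFinP.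
transitivity (limn (fun n => \int[nu]_x (h n x)%:E)).
  rewrite -monotone_convergence//; last by move=> n x _; rewrite lee_fin.
  by apply: eq_integral => x _; apply/esym/cvg_lim => //; exact: hf.
transitivity (limn (fun n => \int[mu]_x ((h n x)%:E * (g x)%:E))); last first.
  rewrite -monotone_convergence//.
  - by apply: eq_integral => x _; apply/cvg_lim => //; apply: cvgeZr.
  - by move=> n; apply: emeasurable_funM.
  - by move=> n x _; rewrite mule_ge0// lee_fin.
  - by move=> x _ a b ab; rewrite lee_wpmul2r ?lee_fin//; exact: ndh.
congr (limn _); apply/funext => n.
rewrite integralT_nnsfun sintegralE.
transitivity (\int[mu]_x (\sum_(r \in range (h n))
    (r%:E * (\1_(h n @^-1` [set r]) x)%:E * (g x)%:E))).
  rewrite ge0_integral_fsum//.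
  - apply: eq_fsbigr => r /set_mem[x _ hxr].
    have r0 : (0 <= r)%R by rewrite -hxr.
    under eq_integral do rewrite -muleA.
    rewrite ge0_integralZl//.
    + congr (_ * _); rewrite nuE//.
      rewrite integral_mkcond; apply: eq_integral => y _.
      rewrite patchE indicE; case: ifP => _; first by rewrite mul1e.
      by rewrite mul0e.
    + by apply: emeasurable_funM => //; exact/measurable_EFinP.
    + by move=> y _; rewrite mule_ge0// lee_fin.
  - move=> r; apply: emeasurable_funM => //; apply: emeasurable_funM => //.
    exact/measurable_EFinP.
  - move=> r x _; apply: mule_ge0; last by rewrite lee_fin.
    exact: nnfun_muleindic_ge0.
apply: eq_integral => x _; rewrite (fimfunE (h n) x) -fsumEFin//.
rewrite ge0_mule_fsuml//.
by move=> r; exact: nnfun_muleindic_ge0.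
Qed.

End density.

(** * Polar coordinates *)

Section radial.
Context {R : realType}.
Local Notation mu := (@lebesgue_measure R).
Local Notation leb2 := (product_sigma_finite mu mu).
Local Open Scope ereal_scope.

Definition sqr_norm (z : plane R) : R := (z.1 ^+ 2 + z.2 ^+ 2)%R.

Lemma measurable_sqr_norm : measurable_fun [set: plane R] sqr_norm.
Proof. by apply: measurable_funD; apply: measurable_funX. Qed.

Definition disc (t : R) : set (plane R) := [set z | (sqr_norm z <= t)%R].

Lemma measurable_disc t : measurable (disc t).
Proof.
rewrite (_ : disc t = sqr_norm @^-1` `]-oo, t]); last first.
  by apply/seteqP; split => z; rewrite /disc /= in_itv.
by rewrite -[X in measurable X]setTI; exact: measurable_sqr_norm.
Qed.

(* [Num.sqrt] vanishes on negative numbers, so that the formula also covers the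
   empty sections |x| > sqrt t and the radii t <= 0. *)
Lemma measure_discE t :
  leb2 (disc t) = \int[mu]_x (2 * Num.sqrt (t - x ^+ 2))%R%:E.
Proof.
rewrite /product_sigma_finite /product_measure1; apply: eq_integral => x _ /=.
have [xt|tx] := leP (x ^+ 2)%R t.
  rewrite (_ : xsection _ _ =
      `[(- Num.sqrt (t - x ^+ 2))%R, Num.sqrt (t - x ^+ 2)]%classic); last first.
    apply/seteqP; split => y; rewrite /xsection/= inE/= in_itv/= /disc/= /sqr_norm/=.
      by rewrite -ler_norml -sqrtr_sqr ler_sqrt ?subr_ge0// lerBrDl.
    by rewrite -ler_norml -sqrtr_sqr ler_sqrt ?subr_ge0// lerBrDl.
  rewrite lebesgue_measure_itv/= lte_fin; case: ltP => h.
    by rewrite -EFinD; congr EFin; ring.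
  by congr EFin; have := sqrtr_ge0 (t - x ^+ 2); lra.
rewrite (_ : xsection _ _ = set0).
  by rewrite measure0 ler0_sqrtr ?mulr0// subr_le0 ltW.
apply/seteqP; split => y //; rewrite /xsection/= inE/= /disc/= /sqr_norm/=.
by have := sqr_ge0 (y : R); move: tx; lra.
Qed.

Definition unit_disc_area : R := fine (leb2 (disc 1)).

Let measure_square (a : R) : (0 < a)%R ->
  leb2 (`[(- a)%R, a] `*` `[(- a)%R, a]) = (4 * a ^+ 2)%R%:E.
Proof.
move=> a0; rewrite /product_sigma_finite product_measure1E//=.
rewrite lebesgue_measure_itv/= lte_fin gtrN// -!EFinD -EFinM; congr EFin; ring.
Qed.

(** Taking [fine] loses nothing: the disc lies in a square of side 2. *)
Lemma measure_unit_disc : leb2 (disc 1) = unit_disc_area%:E.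
Proof.
rewrite fineK// ge0_fin_numE//.
apply: (@le_lt_trans _ _ (leb2 (`[(- 1)%R, 1%R] `*` `[(- 1)%R, 1%R]))).
  apply: le_measure; rewrite ?inE//=.
  - exact: measurable_disc.
  - exact: measurableX.
  move=> [x y]; rewrite /disc /sqr_norm/= !in_itv/= => h.
  by split; apply/andP; split; nra.
by rewrite measure_square// ltry.
Qed.

(** The disc contains a square of side 1. *)
Lemma unit_disc_area_gt0 : (0 < unit_disc_area)%R.
Proof.
rewrite -lte_fin -measure_unit_disc.
apply: (@lt_le_trans _ _
  (leb2 (`[(- 2^-1)%R, 2^-1%R] `*` `[(- 2^-1)%R, 2^-1%R]))).
  by rewrite measure_square ?invr_gt0// lte_fin mulr_gt0// exprn_gt0// invr_gt0.
apply: le_measure; rewrite ?inE//=.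
- exact: measurableX.
- exact: measurable_disc.
move=> [x y]; rewrite /disc /sqr_norm/= !in_itv/= => -[/andP[? ?] /andP[? ?]].
by nra.
Qed.

(** Replacing x by x sqrt t in [measure_discE] yields one factor sqrt t from dx and another from the
    length of the chord. *)
Lemma measure_disc t : leb2 (disc t) = (unit_disc_area * Num.max 0 t)%R%:E.
Proof.
have [t0|t0] := leP t 0%R.
  rewrite mulr0 measure_discE integral0_eq// => x _.
  rewrite ler0_sqrtr ?mulr0// lerBlDr add0r (le_trans t0)//; exact: sqr_ge0.
have mf (s : R) :
    measurable_fun setT (fun x : R => (2 * Num.sqrt (s - x ^+ 2))%R%:E).
  apply/measurable_EFinP/measurable_funM => //.
  apply: (measurableT_comp (continuous_measurable_fun (@sqrt_continuous R))).
  by apply: measurable_funB => //; exact: measurable_funX.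
rewrite mulrC EFinM -measure_unit_disc !measure_discE.
rewrite (@ge0_integral_affine R (Num.sqrt t) 0) ?sqrtr_gt0//.
under eq_integral => x _.
  rewrite addr0 exprMn sqr_sqrtr ?(ltW t0)// -[X in (X - _)%R]mulr1 -mulrBr.
  rewrite sqrtrM ?(ltW t0)// mulrCA EFinM.
  over.
rewrite ge0_integralZl//; last exact: mf.
by rewrite muleA -EFinM -expr2 sqr_sqrtr// ltW.
Qed.

Let unit_disc_area_neq0 : unit_disc_area != 0%R.
Proof. by rewrite gt_eqF// unit_disc_area_gt0. Qed.

Let mq : measurable_fun [set: plane R] (sqr_norm : plane R -> measurableTypeR R).
Proof. exact: measurable_sqr_norm. Qed.

(** Uniqueness of Lebesgue measure concerns the whole line, whereas the image under [sqr_norm] lives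
    on the nonnegative reals. Lebesgue measure on the negatives is therefore added to the rescaled
    image; the sum gives each interval its length, since the preimage of []a, b]] is a difference of
    two discs. *)
Lemma radial_pushforward (A : set (measurableTypeR R)) : measurable A ->
  leb2 (sqr_norm @^-1` A) = unit_disc_area%:E * mu (A `&` `[0%R, +oo[).
Proof.
move=> mA.
have k0 : (0 <= unit_disc_area^-1)%R by rewrite invr_ge0 ltW// unit_disc_area_gt0.
have mneg : measurable (`]-oo, 0%R[%classic : set (measurableTypeR R)) by [].
pose pf : {measure set (measurableTypeR R) -> \bar R} :=
  measure_function_pushforward__canonical__measure_function_Measure
    leb2 mq.
pose nu : {measure set (measurableTypeR R) -> \bar R} :=
  measure_add (mscale (NngNum k0) pf) (mrestr mu mneg).
have nuE X : nu X = (unit_disc_area^-1)%:E * leb2 (sqr_norm @^-1` X)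
    + mu (X `&` `]-oo, 0%R[).
  exact: measure_addE.
have munu X : measurable X -> mu X = nu X.
  apply: (lebesgue_measure_unique (mu := nu)) => _ [[a b]] _ <-.
  rewrite nuE.
  have [ba|ab] := leP b a.
    have -> : [set` `]a, b]] = set0 :> set (measurableTypeR R).
      by apply/set_itv_ge; rewrite -leNgt bnd_simp.
    by rewrite preimage_set0 set0I !measure0 mule0 adde0.
  have -> : leb2 (sqr_norm @^-1` `]a, b]) =
      (unit_disc_area * (Num.max 0 b - Num.max 0 a))%R%:E.
    rewrite (_ : _ @^-1` _ = disc b `\` disc a); last first.
      apply/seteqP; split => z; rewrite /disc/= in_itv/= ltNge.
        by move=> /andP[/negP].
      by move=> [? /negP ?]; apply/andP.
    rewrite measureD; [|exact: measurable_disc|exact: measurable_disc|].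
      rewrite (_ : disc b `&` disc a = disc a).
        rewrite [X in X - _]measure_disc [X in _ - X]measure_disc.
        by rewrite -EFinB mulrBr.
      apply/seteqP; split => z; rewrite /disc/=; first by case.
      by move=> za; split => //; rewrite (le_trans za)// ltW.
    by rewrite [ltLHS]measure_disc ltry.
  rewrite -EFinM mulKf//.
  have [a0|a0] := leP 0%R a.
    rewrite (_ : _ `&` _ = set0) ?measure0 ?adde0; last first.
      by apply/seteqP; split => x //=; rewrite !in_itv/=; move: a0; lra.
    by rewrite lebesgue_measure_itv/= lte_fin ab max_r// (le_trans a0)// ltW.
  have [b0|b0] := ltP b 0%R.
    rewrite subr0 add0e; congr (mu _).
    by apply/seteqP; split => x //=; rewrite !in_itv/=; move: b0; lra.
  rewrite (_ : _ `&` _ = `]a, 0%R[%classic); last first.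
    by apply/seteqP; split => x //=; rewrite !in_itv/=; move: b0; lra.
  by rewrite !lebesgue_measure_itv/= !lte_fin ab a0 -!EFinD; congr EFin; ring.
(* Once A is cut down to the nonnegative half-line, the part of [nu] added on the negatives
   vanishes. *)
rewrite munu ?nuE; last exact: measurableI.
rewrite (_ : A `&` _ `&` _ = set0); last first.
  apply/seteqP; split => x //= [[_]]; rewrite !in_itv/= andbT; lra.
rewrite measure0 adde0 muleA -EFinM divff// mul1e; congr (leb2 _).
apply/seteqP; split => z /=; last by case.
by move=> Az; split => //; rewrite in_itv/= andbT addr_ge0// sqr_ge0.
Qed.

(** In the squared radius the polar Jacobian is constant, so the right-hand side carries no
    weight. *)
Lemma ge0_integral_radial (f : R -> \bar R) :
  measurable_fun setT f -> (forall r, 0 <= f r) ->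
  \int[leb2]_z f (sqr_norm z) =
  unit_disc_area%:E * \int[mu]_(r in `[0%R, +oo[) f r.
Proof.
move=> mf f0.
have k0 : (0 <= unit_disc_area)%R by rewrite ltW// unit_disc_area_gt0.
have mpos : measurable (`[0%R, +oo[%classic : set (measurableTypeR R)) by [].
pose pf : {measure set (measurableTypeR R) -> \bar R} :=
  measure_function_pushforward__canonical__measure_function_Measure
    leb2 mq.
transitivity (\int[pf]_r f r).
  by rewrite [RHS](ge0_integral_pushforward mq).
transitivity (\int[mscale (NngNum k0) (mrestr mu mpos)]_r f r).
  by apply: eq_measure_integral => A mA _; exact: radial_pushforward.
rewrite ge0_integral_mscale//; congr (_ * _).
rewrite (@ge0_integral_density _ _ _ mu _ (\1_(`[0%R, +oo[ : set R)))//.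
  rewrite [RHS]integral_mkcond; apply: eq_integral => r _.
  by rewrite patchE indicE; case: ifP => _; rewrite ?mule1 ?mule0.
by move=> A mA; rewrite integral_indic// setIC.
Qed.
End radial.
Arguments unit_disc_area : clear implicits.

(** * Powers integrated over the half-line *)

Section powR_integral.
Context {R : realType}.
Local Notation mu := (@lebesgue_measure R).

Lemma powR_continuous_at (s x : R) : 0 < x -> {for x, continuous (@powR R ^~ s)}.
Proof.
move=> x0; apply/differentiable_continuous/derivable1_diffP.
by apply: derivable_powR; rewrite in_itv/= andbT.
Qed.

Lemma is_derive_powRD (A s x : R) : 0 < A + x ->
  is_derive x 1 (fun r => (A + r) `^ s) (s * (A + x) `^ (s - 1)).
Proof.
move=> Ax; have h := @is_derive1_powR R s _ Ax.
have h1 : is_derive x 1 (fun r : R => A + r) 1.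
  by rewrite -[X in is_derive _ _ _ X]add0r; exact: is_deriveD.
have := @is_derive1_comp R (@powR R ^~ s) (fun r => A + r) x _ _ h h1.
by rewrite mulr1.
Qed.

Lemma cvg_powRN_pinfty (A s : R) : 0 < s ->
  (A + r) `^ (- s) @[r --> +oo] --> (0 : R).
Proof.
move=> s0; apply/cvgr0Pnorm_lt => e e0; near=> r.
(* The threshold solves x^(-s) = e. *)
have Ar : e `^ (- s^-1) < A + r.
  by rewrite addrC -ltrBlDr; near: r; apply: nbhs_pinfty_gt; rewrite num_real.
have h0 : 0 < e `^ (- s^-1) by rewrite powR_gt0.
rewrite ger0_norm ?powR_ge0// powRN invf_plt ?posrE ?powR_gt0//; last first.
  exact: lt_trans Ar.
have -> : e^-1 = (e `^ (- s^-1)) `^ s.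
  by rewrite -powRrM mulNr mulVf ?gt_eqF// powR_inv1// ltW.
rewrite gt0_ltr_powR// ?nnegrE ?ltW//.
exact: lt_trans Ar.
Unshelve. all: by end_near. Qed.

(** Fundamental theorem of calculus with the primitive -(A + r)^(-s) / s, which vanishes at infinity
    because s > 0. *)
Lemma integral0y_powR (A s : R) : 0 < A -> 0 < s ->
  (\int[mu]_(r in `[0%R, +oo[) ((A + r) `^ (- (s + 1)))%:E =
   (A `^ (- s) / s)%:E)%E.
Proof.
move=> A0 s0; have sn0 : s != 0 by rewrite gt_eqF.
have dF (x : R) : 0 <= x ->
    is_derive x 1 (fun r => - s^-1 * (A + r) `^ (- s)) ((A + x) `^ (- (s + 1))).
  move=> x0; have Ax : 0 < A + x by rewrite ltr_wpDr.
  have h := is_derive_powRD (- s) Ax.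
  apply: is_derive_eq; rewrite /GRing.scale/= -opprD mulrA mulrNN.
  by rewrite mulVf// mul1r.
rewrite (@ge0_continuous_FTC2y _ _ (fun r => - s^-1 * (A + r) `^ (- s)) 0 0)//.
- by rewrite -EFinB addr0 sub0r mulNr opprK mulrC.
- by move=> x _; exact: powR_ge0.
- apply: continuous_in_subspaceT => x /[!inE]/=; rewrite in_itv/= andbT => x0.
  apply: (@continuous_comp _ _ _ (fun r : R => A + r) (@powR R ^~ _)).
    by apply: cvgD; [exact: cvg_cst|exact: cvg_id].
  by apply: powR_continuous_at; rewrite ltr_wpDr.
- rewrite -[X in _ --> X](mulr0 (- s^-1)); apply: cvgMr.
  exact: cvg_powRN_pinfty.
- by move=> x x0; have [] := dF x (ltW x0).
- apply: cvg_at_right_filter.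
  by have [/derivable1_diffP/differentiable_continuous ? _] := dF 0 (lexx _).
- move=> x; rewrite in_itv/= andbT => x0; have [_] := dF x (ltW x0).
  by rewrite derive1E.
Qed.

End powR_integral.

(** * Integration over C^n, one complex line at a time *)

Section tuple_integral.
Context {R : realType}.
Local Notation mu := (@lebesgue_measure R).
Local Notation leb2 := (product_sigma_finite mu mu).
Local Open Scope ereal_scope.

Lemma ge0_integral_Cspace0 (f : Cspace R 0 -> \bar R) :
  measurable_fun setT f ->
  \int[lebesgue_Cspace R 0]_w f w = f [tuple].
Proof.
by move=> mf; rewrite [LHS]integral_dirac// diracE in_setT mul1e.
Qed.

Lemma ge0_integral_CspaceS n (f : Cspace R n.+1 -> \bar R) :
  measurable_fun setT f -> (forall w, 0 <= f w) ->
  \int[lebesgue_Cspace R n.+1]_w f w =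
  \int[leb2]_z \int[lebesgue_Cspace R n]_w f (cons_pair (z, w)).
Proof.
move=> mf f0.
have mc := @measurable_cons_pair _ (plane R) n.
rewrite [LHS](ge0_integral_pushforward mc)//.
rewrite preimage_setT [LHS]fubini_tonelli1//; last by move=> z; exact: f0.
exact: (measurableT_comp mf mc).
Qed.

Definition sqr_sum n (w : Cspace R n) : R := (\sum_(j < n) sqr_norm (tnth w j))%R.

Lemma measurable_sqr_sum n : measurable_fun [set: Cspace R n] (@sqr_sum n).
Proof.
apply: measurable_sum => j; apply: (measurableT_comp measurable_sqr_norm).
exact: measurable_tnth.
Qed.

Lemma sqr_norm_ge0 (z : plane R) : (0 <= sqr_norm z)%R.
Proof. by rewrite addr_ge0// sqr_ge0. Qed.

Lemma sqr_sum_ge0 n (w : Cspace R n) : (0 <= sqr_sum w)%R.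
Proof. by apply: sumr_ge0 => j _; exact: sqr_norm_ge0. Qed.

Lemma sqr_sum_cons n (z : plane R) (w : Cspace R n) :
  sqr_sum (cons_pair (z, w)) = (sqr_norm z + sqr_sum w)%R.
Proof.
rewrite /sqr_sum big_ord_recl; congr (_ + _)%R.
by apply: eq_bigr => j _; rewrite tnthS.
Qed.

(** Induction on n with A general: freezing the first coordinate z replaces A by A + |z|^2, the
    other coordinates leave the power n - M of it, and the radial integral over z supplies the next
    factor of the product. *)
Lemma integral_Cspace_powR n (A M : R) : (0 < A)%R -> (n%:R < M)%R ->
  \int[lebesgue_Cspace R n]_w ((A + sqr_sum w) `^ (- M))%:E =
  (unit_disc_area R ^+ n * A `^ (n%:R - M) / \prod_(i < n) (M - i.+1%:R))%:E.
Proof.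
move=> A0; have mf k (B : R) : measurable_fun setT
    (fun w : Cspace R k => ((B + sqr_sum w) `^ (- M))%:E).
  apply/measurable_EFinP/(measurableT_comp (measurable_powR _)).
  by apply: measurable_funD => //; exact: measurable_sqr_sum.
elim: n A A0 => [|n ih] A A0 nM.
  rewrite ge0_integral_Cspace0//= /sqr_sum !big_ord0 addr0 sub0r expr0.
  by rewrite mul1r divr1.
have nM' : (n%:R < M)%R by rewrite (lt_trans _ nM)// ltr_nat.
rewrite ge0_integral_CspaceS//; last by move=> w; rewrite lee_fin powR_ge0.
under eq_integral => z _.
  under eq_integral do rewrite sqr_sum_cons addrA.
  rewrite ih ?ltr_wpDr ?sqr_norm_ge0//.
  over.
pose c : R := (unit_disc_area R ^+ n / \prod_(i < n) (M - i.+1%:R))%R.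
have p0 k : (k%:R < M)%R -> (0 < \prod_(i < k) (M - i.+1%:R))%R.
  move=> kM; apply: prodr_gt0 => i _; rewrite subr_gt0 (le_lt_trans _ kM)//.
  by rewrite ler_nat.
have c0 : (0 <= c)%R.
  by rewrite divr_ge0 ?exprn_ge0// ltW ?unit_disc_area_gt0 ?p0.
pose g (r : R) := (c * (A + `|r|) `^ (n%:R - M))%:E.
rewrite (eq_integral (g \o sqr_norm)); last first.
  move=> z _; rewrite /g/= ger0_norm ?sqr_norm_ge0//; congr EFin; rewrite /c; ring.
have mg0 (a : R): measurable_fun setT (fun r : R => ((A + `|r|) `^ a)%:E).
  apply/measurable_EFinP/(measurableT_comp (measurable_powR _)).
  by apply: measurable_funD => //; exact: measurable_normr.
rewrite ge0_integral_radial; last 2 first.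
- by rewrite /g; under eq_fun do rewrite EFinM; apply: measurable_funeM.
- by move=> r; rewrite lee_fin mulr_ge0// powR_ge0.
rewrite /g; under eq_integral => r.
  rewrite inE/= in_itv/= andbT => r0.
  (* The exponent takes the form required by [integral0y_powR] with s = M - (n + 1), positive by
     [nM]. *)
  rewrite ger0_norm// EFinM (_ : (n%:R - M = - ((M - n.+1%:R) + 1))%R); last first.
    by rewrite -[in RHS]natr1; ring.
  over.
rewrite /= ge0_integralZl//; last 2 first.
- apply/measurable_funTS/measurable_EFinP/(measurableT_comp (measurable_powR _)).
  exact: measurable_funD.
- by move=> r _; rewrite lee_fin powR_ge0.
rewrite integral0y_powR ?subr_gt0// -!EFinM; congr EFin.
rewrite big_ord_recr/= opprB /c exprS; field.
by rewrite -natr1 in nM; rewrite !gt_eqF ?p0// subr_gt0 addrC.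
Qed.

End tuple_integral.

(** * From the half-line to the unit interval *)

Section beta_substitution.
Context {R : realType}.
Local Notation mu := (@lebesgue_measure R).

(** This is r / (1 + r) for r >= 0; in this form 1 - F and the derivative of F are plain powers of 1
    + r. *)
Let F (r : R) : R := 1 - (1 + r) `^ (-1).

Let dF (x : R) : 0 < 1 + x -> is_derive x 1 F ((1 + x) `^ (-2)).
Proof.
move=> x0; have h := is_derive_powRD (-1) x0.
have -> : (1 + x) `^ (-2) = 0 - (-1) * (1 + x) `^ (-1 - 1).
  by rewrite sub0r mulN1r opprK; congr powR; lra.
exact: is_deriveB.
Qed.

Let FE (r : R) : 0 <= r -> F r = r / (1 + r).
Proof.
move=> r0; rewrite /F powR_inv1; last by rewrite addr_ge0.
by field; rewrite gt_eqF// ltr_wpDr.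
Qed.

Let onemF (r : R) : 1 - F r = (1 + r) `^ (-1).
Proof. by rewrite /F opprB addrC subrK. Qed.

Let F_lt1 (r : R) : 0 <= r -> F r < 1.
Proof. by move=> r0; rewrite ltrBlDr ltrDl powR_gt0// ltr_wpDr. Qed.

Let F0 : F 0 = 0.
Proof. by rewrite FE// mul0r. Qed.

Let F_lt : {in Num.nneg &, {homo F : x y / x < y}}.
Proof.
move=> x y; rewrite !nnegrE => x0 y0 xy.
rewrite ltrD2l ltrN2 !powR_inv1 ?addr_ge0//.
by rewrite ltf_pV2 ?posrE ?ltrD2l// ltr_wpDr.
Qed.

Let cF' (x : R) : 0 < 1 + x -> F^`()%classic y @[y --> x] --> (1 + x) `^ (-2).
Proof.
move=> x0.
have : (1 + y) `^ (-2) @[y --> x] --> (1 + x) `^ (-2).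
  apply: (@continuous_comp _ _ _ (fun r : R => 1 + r) (@powR R ^~ _)).
    by apply: cvgD; [exact: cvg_cst|exact: cvg_id].
  exact: powR_continuous_at.
apply: cvg_trans; apply: near_eq_cvg; near=> y.
have [|_ <-] := @dF y; last by rewrite derive1E.
rewrite -ltrBlDl sub0r; near: y; apply: lt_nbhsr; lra.
Unshelve. all: by end_near. Qed.

(** Substitute t = r / (1 + r) on each segment [0, m + 1] and let m tend to infinity: the
    r-integrals exhaust the half-line while F(m + 1) increases to 1. Continuity of the integrand at
    t = 0 comes from a > 0. *)
Lemma integral0y_beta (a b : R) : 0 < a ->
  (\int[mu]_(r in `[0%R, +oo[) (r `^ a * (1 + r) `^ (- (a + b + 2)))%:E =
   \int[mu]_(t in `[0%R, 1%R]) (t `^ a * (1 - t) `^ b)%:E)%E.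
Proof.
move=> a0; pose G (t : R) := t `^ a * (1 - t) `^ b.
have mG : measurable_fun setT (EFin \o G).
  apply/measurable_EFinP/measurable_funM; first exact: measurable_powR.
  apply: (measurableT_comp (measurable_powR _)); exact: measurable_funB.
have cG1 (x : R) : x < 1 -> (1 - t) `^ b @[t --> x] --> (1 - x) `^ b.
  move=> x1; apply: (@continuous_comp _ _ _ (fun r : R => 1 - r) (@powR R ^~ _)).
    by apply: cvgB; [exact: cvg_cst|exact: cvg_id].
  by apply: powR_continuous_at; rewrite subr_gt0.
have cG (x : R) : 0 < x < 1 -> {for x, continuous G}.
  move=> /andP[x0 x1]; apply: cvgM; last exact: cG1.
  exact: powR_continuous_at.
pose f (r : R) := r `^ a * (1 + r) `^ (- (a + b + 2)).
have subst (m : nat) : (\int[mu]_(t in `[0%R, F m.+1%:R]) (G t)%:E =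
    \int[mu]_(r in `[0%R, m.+1%:R]) (f r)%:E)%E.
  have m0 : 0 < m.+1%:R :> R by [].
  have dFm (x : R) : 0 <= x -> derivable F x 1.
    by move=> x0; have [] := @dF x; rewrite ?ltr_wpDr.
  have cFm (x : R) : 0 <= x -> {for x, continuous F}.
    by move=> /dFm /derivable1_diffP/differentiable_continuous.
  have := @integration_by_substitution_increasing R F G 0 m.+1%:R (ltW m0).
  rewrite F0 => -> //.
  - apply: eq_integral => r /[!inE]/=; rewrite in_itv/= => /andP[r0 _].
    have r1 : 0 < 1 + r by rewrite ltr_wpDr.
    have r1' : 0 <= 1 + r by rewrite ltW.
    congr EFin; rewrite /GRing.mul/= /f /G onemF FE//.
    have [_] := dF r1; rewrite -derive1E => ->.
    rewrite powRM ?invr_ge0// -powR_inv1// -!powRrM -!mulrA.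
    rewrite -!powRD ?(gt_eqF r1) ?implybT//.
    by congr (_ * _ `^ _); ring.
  - by move=> x y; rewrite !in_itv/= => /andP[x0 _] /andP[y0 _]; exact: F_lt.
  - move=> x; rewrite in_itv/= => /andP[x0 _].
    have x1 : 0 < 1 + x by rewrite addr_gt0.
    rewrite /prop_for /continuous_at.
    by have := cF' x1; have [_] := dF x1; rewrite -derive1E => ->.
  - apply/cvg_ex; eexists; apply: cvg_at_right_filter; apply: cF'; lra.
  - apply/cvg_ex; eexists; apply: cvg_at_left_filter; apply: cF'.
    by rewrite addr_gt0.
  - split.
    + by move=> x; rewrite in_itv/= => /andP[/ltW x0 _]; exact: dFm.
    + by apply: cvg_at_right_filter; exact: cFm.
    + by apply: cvg_at_left_filter; exact: cFm.
  - apply/continuous_within_itvP.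
      by rewrite -F0 F_lt// nnegrE.
    split.
    + move=> x; rewrite in_itv/= => /andP[x0 xm]; apply: cG.
      by rewrite x0/= (lt_trans xm)// F_lt1.
    + rewrite /G powR0 ?gt_eqF//; apply: cvgM; first exact: powR_cvg0.
      apply: cvg_at_right_filter; exact: cG1.
    + apply: cvg_at_left_filter; apply: cG.
      by rewrite F_lt1// andbT -F0 F_lt// nnegrE.
have f0 (r : R) : 0 <= f r by rewrite mulr_ge0 ?powR_ge0.
have mf : measurable_fun setT f.
  apply/measurable_funM; first exact: measurable_powR.
  apply: (measurableT_comp (measurable_powR _)); exact: measurable_funD.
have := @ge0_cvgn_integral R mu f f0 mf; rewrite -cvg_shiftS.
under eq_fun do rewrite -subst.
move=> /cvg_lim <-//.
have := @ge0_nondecreasing_set_cvg_integral _ (measurableTypeR R) R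
  (fun m => `[0%R, F m.+1%:R]%classic) (EFin \o G) mu.
move=> /(_ _ _ _ _)/cvg_lim => ->//.
- rewrite (_ : \bigcup_i _ = `[0%R, 1%R[%classic).
    by rewrite integral_itv_bndo_bndc//; exact: measurable_funTS.
  apply/seteqP; split => x /=.
    move=> [m _ /=]; rewrite !in_itv/= => /andP[-> xm]/=.
    by rewrite (le_lt_trans xm)// F_lt1.
  rewrite in_itv/= => /andP[x0 x1].
  (* F(m + 1) = 1 - 1/(m + 2) exceeds x as soon as m >= 1/(1 - x). *)
  have [m _ /(_ m (leqnn m))/= hm] := nbhs_infty_ger (1 - x)^-1.
  exists m => //=; rewrite in_itv/= x0/= -[x](subKr 1%R) lerD2l lerN2.
  rewrite powR_inv1// -[leRHS]invrK lef_pV2 ?posrE ?invr_gt0 ?subr_gt0//.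
  by rewrite (le_trans hm)// -natr1; lra.
- apply/nondecreasing_seqP => m; rewrite subsetEset; apply: subset_itvl.
  by rewrite bnd_simp ltW// F_lt ?nnegrE// ltr_nat.
- by move=> i; exact: measurable_funTS.
- by move=> i x _; rewrite lee_fin mulr_ge0// powR_ge0.
Qed.
End beta_substitution.

(** * Laplace's method *)

Section sequences_limits.
Context {R : realType}.

Lemma cvg_natV : (n%:R : R)^-1 @[n --> \oo] --> (0 : R).
Proof.
apply/gtr0_cvgV0; last exact: cvgr_idn.
by near=> n; rewrite ltr0n; near: n; exact: nbhs_infty_gt.
Unshelve. all: by end_near. Qed.

Lemma cvg_sqrt_natV : (Num.sqrt (n%:R : R))^-1 @[n --> \oo] --> (0 : R).
Proof.
have -> : (fun n => (Num.sqrt (n%:R : R))^-1) = (fun n => Num.sqrt n%:R^-1).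
  by apply/funext => n; rewrite sqrtrV.
rewrite -[X in _ --> X]sqrtr0; apply: continuous_cvg; last exact: cvg_natV.
exact: sqrt_continuous.
Qed.

Lemma natr_half (N : nat) : N%:R = 2 * N./2%:R + (odd N)%:R :> R.
Proof. by rewrite -[in LHS](odd_double_half N) natrD -mul2n natrM addrC. Qed.

Lemma natr_uphalf (N : nat) : (N - N./2)%:R = N./2%:R + (odd N)%:R :> R.
Proof.
have h : (N./2 <= N)%N by rewrite -{2}(odd_double_half N) -addnn addnA leq_addl.
by rewrite natrB// (natr_half N); ring.
Qed.

Lemma cvg_half_ratio : N./2%:R / N%:R @[N --> \oo] --> (2^-1 : R).
Proof.
apply: (@squeeze_cvgr _ _ _ _ (fun N => 2^-1 - N%:R^-1) (cst 2^-1)); last 2 first.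
- rewrite -[X in _ --> X]subr0; apply: cvgB; [exact: cvg_cst|exact: cvg_natV].
- exact: cvg_cst.
near=> N; have N0 : 0 < N%:R :> R.
  by rewrite ltr0n; near: N; exact: nbhs_infty_gt.
rewrite ler_pdivlMr// ler_pdivrMr// mulrBl mulVf ?gt_eqF//.
have := natr_half N.
have : 0 <= ((odd N)%:R : R) <= 1 by case: odd; rewrite ?lexx ler01.
rewrite /=; lra.
Unshelve. all: by end_near. Qed.

(** Apply ln(1 + v) <= v to 1/(1 - u) = 1 + u/(1 - u). *)
Lemma ln1B_ge (u : R) : 0 <= u < 1 -> - (u / (1 - u)) <= ln (1 - u).
Proof.
move=> /andP[u0 u1]; have u2 : 0 < 1 - u by rewrite subr_gt0.
rewrite -[ln _]opprK lerN2 -lnV ?posrE//.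
have h : (1 - u)^-1 = 1 + u / (1 - u) by field; rewrite gt_eqF.
rewrite [X in ln X]h; apply: le_ln1Dx.
by rewrite (lt_le_trans (ltrN10 _))// divr_ge0// ltW.
Qed.

(** Squeezed between -c/(1 - c/N) and -c. *)
Lemma cvg_natM_ln1B (c : R) : 0 <= c ->
  N%:R * ln (1 - c / N%:R) @[N --> \oo] --> - c.
Proof.
move=> c0.
have cN : c / N%:R @[N --> \oo] --> (0 : R).
  by rewrite -(mulr0 c); apply: cvgMr; exact: cvg_natV.
apply: (@squeeze_cvgr _ _ _ _ (fun N => - (c / (1 - c / N%:R))) (cst (- c))).
- near=> N; have N0 : 0 < N%:R :> R.
    by rewrite ltr0n; near: N; exact: nbhs_infty_gt.
  have cN0 : 0 <= c / N%:R by rewrite divr_ge0// ltW.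
  have cN1 : c / N%:R < 1 by near: N; apply: cvgr_lt cN _ _.
  apply/andP; split.
    have -> : - (c / (1 - c / N%:R)) =
        N%:R * - ((c / N%:R) / (1 - c / N%:R)).
      by field; rewrite !gt_eqF// subr_gt0 -[ltRHS]mul1r -ltr_pdivrMr.
    by rewrite ler_pM2l// ln1B_ge// cN0.
  rewrite [leLHS]mulrC -ler_pdivlMr// mulNr; apply: le_ln1Dx.
  by rewrite ltrN2.
- rewrite -[X in _ --> - X]divr1 -[X in _ / X]subr0.
  apply: cvgN; apply: cvgMr; apply: cvgV; first by rewrite subr0 oner_eq0.
  by apply: cvgB; [exact: cvg_cst|exact: cN].
- exact: cvg_cst.
Unshelve. all: by end_near. Qed.

End sequences_limits.

(** * Rescaled beta weights and their Gaussian limit *)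

Section laplace.
Context {R : realType}.
Local Notation mu := (@lebesgue_measure R).

Lemma integral_gauss_scaled (s : R) : 0 < s ->
  (\int[mu]_x (expR (- (s * x ^+ 2)))%:E = (Num.sqrt (pi / s))%:E)%E.
Proof.
move=> s0.
have mg : measurable_fun setT (fun x : R => (expR (- (s * x ^+ 2)))%:E).
  apply/measurable_EFinP/(measurableT_comp (@measurable_expR R)).
  apply: measurable_funN; apply: measurable_funM => //; exact: measurable_funX.
rewrite (@ge0_integral_affine R (Num.sqrt s)^-1 0) ?invr_gt0 ?sqrtr_gt0//.
under eq_integral => x _.
  rewrite addr0 exprMn exprVn sqr_sqrtr ?ltW// mulrA divff ?gt_eqF// mul1r.
  over.
rewrite [X in (_ * X)%E]integralT_gauss -EFinM; congr EFin.
by rewrite sqrtrM ?pi_ge0// sqrtrV ?ltW// mulrC.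
Qed.

(** What remains of the q-th power of the pointwise norm, up to a factor depending on N, once w_2,
    ..., w_n are integrated out and t = r / (1 + r) replaces r = |w_1|^2. *)
Definition beta_weight (q : R) (N : nat) (t : R) : R :=
  t `^ (N./2%:R * (q / 2)) * (1 - t) `^ ((N - N./2)%:R * (q / 2)).

(* [2 ^ (N q / 2)] times [beta_weight] in the variable t = (1 + y / sqrt N) / 2 *)
Definition laplace_fun (q : R) (N : nat) (y : R) : R :=
  2 `^ (N%:R * (q / 2)) *
  (beta_weight q N \_ `[0%R, 1%R]) ((2 * Num.sqrt N%:R)^-1 * y + 2^-1).

Lemma measurable_beta_weight q N : measurable_fun setT (beta_weight q N).
Proof.
apply/measurable_funM; first exact: measurable_powR.
apply: (measurableT_comp (measurable_powR _)); exact: measurable_funB.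
Qed.

Lemma beta_weight_ge0 q N t : 0 <= beta_weight q N t.
Proof. by rewrite mulr_ge0// powR_ge0. Qed.

Let patch_ge0 q N t : 0 <= (beta_weight q N \_ `[0%R, 1%R]) t.
Proof. by rewrite patchE; case: ifP => // _; exact: beta_weight_ge0. Qed.

Let measurable_patch q N : measurable_fun setT (beta_weight q N \_ `[0%R, 1%R]).
Proof.
apply/(measurable_restrictT _ _).1 => //.
by apply: measurable_funTS; exact: measurable_beta_weight.
Qed.

Lemma laplace_fun_ge0 q N y : 0 <= laplace_fun q N y.
Proof. by rewrite mulr_ge0 ?powR_ge0. Qed.

Lemma measurable_laplace_fun q N : measurable_fun setT (laplace_fun q N).
Proof.
apply: measurable_funM => //; apply: (measurableT_comp (measurable_patch _ _)).
by apply: measurable_funD => //; exact: measurable_funM.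
Qed.

Lemma integral_laplace_fun q N : (0 < N)%N ->
  ((2 * Num.sqrt N%:R * 2 `^ (N%:R * (q / 2)))%:E *
   \int[mu]_(t in `[0%R, 1%R]) (beta_weight q N t)%:E =
   \int[mu]_y (laplace_fun q N y)%:E)%E.
Proof.
move=> N0; have s0 : 0 < Num.sqrt (N%:R : R) by rewrite sqrtr_gt0 ltr0n.
have c0 : 0 < (2 * Num.sqrt (N%:R : R))^-1 by rewrite invr_gt0 mulr_gt0.
pose P := beta_weight q N \_ `[0%R, 1%R].
transitivity ((2 * Num.sqrt N%:R * 2 `^ (N%:R * (q / 2)))%:E *
    \int[mu]_t (P t)%:E)%E.
  rewrite integral_mkcond; congr (_ * _)%E; apply: eq_integral => t _.
  by rewrite restrict_EFin.
have mP : measurable_fun setT (EFin \o P).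
  by apply/measurable_EFinP; exact: measurable_patch.
rewrite (@ge0_integral_affine R (2 * Num.sqrt N%:R)^-1 2^-1 (EFin \o P))//;
  last first.
  by move=> x; rewrite /= lee_fin; exact: patch_ge0.
rewrite muleA -EFinM mulrAC divff ?mul1r; last by rewrite gt_eqF// mulr_gt0.
rewrite -ge0_integralZl//.
- apply: (measurableT_comp mP).
  by apply: measurable_funD => //; exact: measurable_funM.
- by move=> x _; rewrite /= lee_fin; exact: patch_ge0.
Qed.

Let in_range (N : nat) (y : R) : (0 < N)%N ->
  ((2 * Num.sqrt N%:R)^-1 * y + 2^-1 \in `[0%R, 1%R]) =
  (`|y / Num.sqrt N%:R| <= 1).
Proof.
move=> N0; have s0 : 0 < Num.sqrt (N%:R : R) by rewrite sqrtr_gt0 ltr0n.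
rewrite invfM -mulrA [_^-1 * y]mulrC in_itv/= ler_norml.
by apply/idP/idP; lra.
Qed.

Lemma laplace_fun_out q N y : (0 < N)%N -> 1 < `|y / Num.sqrt N%:R| ->
  laplace_fun q N y = 0.
Proof.
move=> N0 y1; rewrite /laplace_fun patchE mem_setE in_range//.
by rewrite leNgt y1/= mulr0.
Qed.

(** With x = y / sqrt N the powers of 2 cancel. The two exponents differ only by q/2 times the
    parity of N, so their common part combines into a power of (1 + x)(1 - x) = 1 - y^2/N. *)
Lemma laplace_funE q N y : (0 < N)%N -> 0 < q -> `|y / Num.sqrt N%:R| <= 1 ->
  laplace_fun q N y = (1 - y ^+ 2 / N%:R) `^ (N./2%:R * (q / 2)) *
    (1 - y / Num.sqrt N%:R) `^ ((odd N)%:R * (q / 2)).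
Proof.
move=> N0 q0 y1; rewrite /laplace_fun patchE mem_setE in_range// y1.
have sn0 : Num.sqrt (N%:R : R) != 0 by rewrite gt_eqF// sqrtr_gt0 ltr0n.
set x := y / _ in y1 *; rewrite /beta_weight.
have -> : y ^+ 2 / N%:R = x ^+ 2 by rewrite exprMn exprVn sqr_sqrtr.
have -> : (2 * Num.sqrt N%:R)^-1 * y + 2^-1 = (1 + x) / 2 by rewrite /x; field.
have -> : 1 - (1 + x) / 2 = (1 - x) / 2 by field.
have [x1 x2] : 0 <= 1 + x /\ 0 <= 1 - x by move: y1; rewrite ler_norml; lra.
have -> : 1 - x ^+ 2 = (1 + x) * (1 - x) by ring.
set k := N./2%:R * (q / 2); set e := (odd N)%:R * (q / 2).
have Nk : N%:R * (q / 2) = k + (k + e) by rewrite natr_half /k /e; ring.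
have ke : (N - N./2)%:R * (q / 2) = k + e by rewrite natr_uphalf mulrDl.
(* The base 1 - x may vanish, and splitting its power then requires a nonzero total exponent. *)
have ke0 : k + e != 0.
  rewrite -ke mulf_neq0// ?gt_eqF ?divr_gt0// ltr0n subn_gt0.
  by rewrite -divn2 ltn_Pdiv.
rewrite Nk ke !powRM ?invr_ge0// !(@powRD _ 2) ?implybT//; last 2 first.
- by rewrite pnatr_eq0 implybT.
- by rewrite pnatr_eq0 implybT.
rewrite !(@powRD _ (1 - x)) ?(negPf ke0)//.
rewrite !(@powRD _ 2^-1) ?invr_eq0 ?pnatr_eq0 ?implybT//.
have h2 (z : R) : 2 `^ z * 2^-1 `^ z = 1.
  by rewrite -powRM ?invr_ge0// divff ?pnatr_eq0// powR1.
transitivity ((2 `^ k * 2^-1 `^ k) ^+ 2 * (2 `^ e * 2^-1 `^ e) *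
    ((1 + x) `^ k * (1 - x) `^ k * (1 - x) `^ e)); last by rewrite !h2; ring.
ring.
Qed.

(** The dominating function for the limit under the integral. From 1 - u <= e^(-u) the main factor
    is at most exp(-(k/N)(q/2) y^2) with k = [N./2], where k/N >= 1/3 and q/2 >= 1; the parity
    factor is at most 2^(q/2). At N = 1 one has k = 0 and no decay, hence [1 < N]. *)
Lemma laplace_fun_le q N y : (1 < N)%N -> 2 <= q ->
  laplace_fun q N y <= 2 `^ (q / 2) * expR (- (3^-1 * y ^+ 2)).
Proof.
move=> N1 q2; have N0 : (0 < N)%N by rewrite ltnW.
have q0 : 0 < q by rewrite (lt_le_trans _ q2).
have [y1|y1] := leP `|y / Num.sqrt N%:R| 1; last first.
  by rewrite laplace_fun_out// mulr_ge0 ?powR_ge0 ?expR_ge0.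
rewrite laplace_funE// mulrC.
have Npos : 0 < N%:R :> R by rewrite ltr0n.
have yN : 0 <= y ^+ 2 / N%:R by rewrite divr_ge0// sqr_ge0.
have yN1 : y ^+ 2 / N%:R <= 1.
  rewrite (_ : _ / _ = `|y / Num.sqrt N%:R| ^+ 2) ?exprn_ile1//.
  by rewrite real_normK ?num_real// exprMn exprVn sqr_sqrtr.
apply: ler_pM; rewrite ?powR_ge0//.
- apply: (@le_trans _ _ (2 `^ ((odd N)%:R * (q / 2)))).
    apply: ge0_ler_powR; rewrite ?nnegrE//.
    + by rewrite mulr_ge0// ltW// divr_gt0.
    + by move: y1; rewrite ler_norml; lra.
    + by move: y1; rewrite ler_norml; lra.
  apply: ler_powR; first lra.
  by case: odd; rewrite ?mul1r// mul0r divr_ge0// ltW.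
(* Equality holds at N = 3, which fixes the constant 1/3 in the Gaussian bound. *)
- have kN : N%:R <= 3 * N./2%:R :> R.
    rewrite -natrM ler_nat; case: N N1 {N0 y1 Npos yN yN1} => [|[|[|[|N]]]]//= _.
    by rewrite /= -{1}(odd_double_half N) !mulnS; case: odd; lia.
  apply: (@le_trans _ _ (expR (- (y ^+ 2 / N%:R)) `^ (N./2%:R * (q / 2)))).
    apply: ge0_ler_powR; rewrite ?nnegrE ?expR_ge0//.
    + by rewrite mulr_ge0// divr_ge0// ltW.
    + by rewrite subr_ge0.
    + exact: expR_ge1Dx.
  rewrite -expRM ler_expR mulNr lerN2.
  have -> : y ^+ 2 / N%:R * (N./2%:R * (q / 2)) =
      (N./2%:R / N%:R * (q / 2)) * y ^+ 2 by ring.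
  apply: ler_wpM2r; first exact: sqr_ge0.
  apply: (@le_trans _ _ (N./2%:R / N%:R)).
    by rewrite ler_pdivlMr//; move: kN; lra.
  rewrite ler_peMr ?divr_ge0//; lra.
Qed.

(** The main factor is the exponential of (k/N)(q/2) times N ln(1 - y^2/N), with k/N -> 1/2 and N
    ln(1 - y^2/N) -> -y^2; the parity factor tends to 1. *)
Lemma cvg_laplace_fun q y : 0 < q ->
  laplace_fun q N y @[N --> \oo] --> expR (- (q / 4 * y ^+ 2)).
Proof.
move=> q0.
have ycvg : y / Num.sqrt N%:R @[N --> \oo] --> (0 : R).
  by rewrite -(mulr0 y); apply: cvgMr; exact: cvg_sqrt_natV.
have y2cvg : y ^+ 2 / N%:R @[N --> \oo] --> (0 : R).
  by rewrite -(mulr0 (y ^+ 2)); apply: cvgMr; exact: cvg_natV.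
(* The parity factor alternates between two expressions; writing it as 1 plus the parity times a
   null sequence treats both at once. *)
have lim : expR (N./2%:R / N%:R * (q / 2) * (N%:R * ln (1 - y ^+ 2 / N%:R))) *
    (1 + (odd N)%:R * ((1 - y / Num.sqrt N%:R) `^ (q / 2) - 1)) @[N --> \oo]
    --> expR (2^-1 * (q / 2) * - (y ^+ 2)) * (1 + 0).
  apply: cvgM.
    apply: continuous_cvg; first exact: continuous_expR.
    apply: cvgM; last by apply: cvg_natM_ln1B; exact: sqr_ge0.
    by apply: cvgMl; exact: cvg_half_ratio.
  apply: cvgD; first exact: cvg_cst.
  have h : (1 - y / Num.sqrt N%:R) `^ (q / 2) - 1 @[N --> \oo] --> (0 : R).
    have p1 : (1 - 0 : R) `^ (q / 2) - 1 = 0 by rewrite subr0 powR1 subrr.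
    rewrite -[X in _ --> X]p1.
    apply: cvgB; last exact: cvg_cst.
    apply: (@continuous_cvg _ _ _ _ _ _ (@powR R ^~ (q / 2))).
      by apply: powR_continuous_at; rewrite subr0.
    by apply: cvgB => //; exact: cvg_cst.
  apply/cvgr0Pnorm_lt => e e0.
  near=> N; apply: (@le_lt_trans _ _ `|(1 - y / Num.sqrt N%:R) `^ (q / 2) - 1|).
    by rewrite normrM; case: odd; rewrite ?normr1 ?mul1r// normr0 mul0r.
  by near: N; apply: cvgr0_norm_lt.
have -> : expR (- (q / 4 * y ^+ 2)) = expR (2^-1 * (q / 2) * - (y ^+ 2)) * (1 + 0).
  by rewrite addr0 mulr1; congr expR; field.
apply: cvg_trans lim; apply: near_eq_cvg; near=> N.
have N0 : (0 < N)%N by near: N; exact: nbhs_infty_gt.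
have Npos : 0 < N%:R :> R by rewrite ltr0n.
have y1 : `|y / Num.sqrt N%:R| <= 1.
  by near: N; apply: cvgr0_norm_le ycvg _ _.
have y21 : y ^+ 2 / N%:R < 1 by near: N; apply: cvgr_lt y2cvg _ _.
rewrite laplace_funE//; congr (_ * _); last first.
  by case: odd; rewrite ?mul1r ?mul0r ?addr0 ?powRr0// addrC subrK.
rewrite /powR gt_eqF ?subr_gt0//; congr expR; field.
by rewrite gt_eqF.
Unshelve. all: by end_near. Qed.

(** Dominated convergence, shifted by 2 because the Gaussian bound starts at N = 2. *)
Lemma cvg_integral_laplace_fun q : 2 <= q ->
  (\int[mu]_y (laplace_fun q N y)%:E @[N --> \oo] -->
    (Num.sqrt (pi / (q / 4)))%:E)%E.
Proof.
move=> q2; have q0 : 0 < q by rewrite (lt_le_trans _ q2).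
rewrite -integral_gauss_scaled ?divr_gt0// -(cvg_shiftn 2).
pose g (y : R) : \bar R := ((2 `^ (q / 2))%:E * (expR (- (3^-1 * y ^+ 2)))%:E)%E.
have mexp (s : R) : measurable_fun setT (fun y : R => (expR (- (s * y ^+ 2)))%:E).
  apply/measurable_EFinP/(measurableT_comp (@measurable_expR R)).
  by apply: measurable_funN; apply: measurable_funM => //; exact: measurable_funX.
have [] := @dominated_convergence _ _ R mu setT measurableT
  (fun N y => (laplace_fun q (N + 2) y)%:E)
  (fun y => (expR (- (q / 4 * y ^+ 2)))%:E) g => //.
- by move=> N; apply/measurable_EFinP; exact: measurable_laplace_fun.
- exact: mexp.
- apply: aeW => y _; apply: cvg_EFin; first exact: nearW.
  by rewrite (cvg_shiftn 2 (fun N => laplace_fun q N y)); exact: cvg_laplace_fun.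
- apply: integrableZl => //; apply/integrableP; split; first exact: mexp.
  under eq_integral do rewrite gee0_abs ?lee_fin ?expR_ge0//.
  by rewrite integral_gauss_scaled ?ltry.
- apply: aeW => y N _; rewrite gee0_abs ?lee_fin ?laplace_fun_ge0//.
  by rewrite laplace_fun_le// addn2.
Qed.
End laplace.

(** * Norms of the basis sections *)

Section pointwise_norm.
Context {R : realType}.

Lemma normc_real (x : R) : normc (x%:C)%C = `|x|.
Proof. by rewrite /normc /= expr0n/= addr0 sqrtr_sqr. Qed.

Lemma normcX (z : R[i]) k : normc (z ^+ k) = normc z ^+ k.
Proof. by elim: k => [|k ih]; rewrite ?normc1// !exprS normcM ih. Qed.

Lemma normc_ge0 (z : R[i]) : 0 <= normc z.
Proof. by case: z => a b; exact: sqrtr_ge0. Qed.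

Lemma tensor_normZ n N (c : R[i]) (T : tensor R n N) :
  tensor_norm (c *: T) = normc c * tensor_norm T.
Proof.
rewrite /tensor_norm -[normc c]ger0_norm ?normc_ge0// -sqrtr_sqr -sqrtrM ?sqr_ge0//.
congr Num.sqrt; rewrite mulr_sumr; apply: eq_bigr => t _.
by rewrite !ffunE normcM exprMn.
Qed.

(** Distributivity: the N-th power of a sum is a sum over all index functions, which correspond to
    the index tuples of the tensor. *)
Lemma tensor_norm_power n N (v : 'I_n.+1 -> R[i]) :
  tensor_norm (tensor_power N v) = Num.sqrt (\sum_i normc (v i) ^+ 2) ^+ N.
Proof.
set s := \sum_i _; have s0 : 0 <= s by apply: sumr_ge0 => i _; exact: sqr_ge0.
rewrite /tensor_norm; have -> : \sum_t normc (tensor_power N v t) ^+ 2 = s ^+ N.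
  rewrite -[N in RHS]card_ord -prodr_const bigA_distr_bigA/=.
  rewrite (reindex (@tuple_of_finfun _ _)); last first.
    by exists (@finfun_of_tuple _ _) => t _;
      [exact: tuple_of_finfunK|exact: finfun_of_tupleK].
  apply: eq_bigr => f _; rewrite ffunE.
  rewrite (big_morph (@normc R) (@normcM R) (@normc1 R)) -prodrXl.
  by apply: eq_bigr => i _; rewrite tnth_map tnth_ord_tuple.
by rewrite -[s in LHS](sqr_sqrtr s0) -exprM mulnC exprM sqrtr_sqr ger0_norm.
Qed.

Lemma normc_chart_coord n (w : Cspace R n) j :
  normc (chart_coord w j) = Num.sqrt (sqr_norm (tnth w j)).
Proof. by []. Qed.

Lemma bracketE n (w : Cspace R n) : bracket w = Num.sqrt (1 + sqr_sum w).
Proof.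
rewrite /bracket; congr (Num.sqrt (1 + _)); apply: eq_bigr => j _.
by rewrite normc_chart_coord sqr_sqrtr// sqr_norm_ge0.
Qed.

Lemma bracket_gt0 n (w : Cspace R n) : 0 < bracket w.
Proof. by rewrite bracketE sqrtr_gt0 ltr_pwDl// sqr_sum_ge0. Qed.

Lemma sum_normc_wtilde n (w : Cspace R n) :
  Num.sqrt (\sum_i normc (wtilde w i) ^+ 2) = bracket w.
Proof.
rewrite /bracket big_ord_recl {1}/wtilde unlift_none normc1 expr1n.
congr (Num.sqrt (1 + _)); apply: eq_bigr => j _; rewrite /wtilde liftK.
by rewrite /normc /= sqrrN.
Qed.

(** The quantity c_N, the square of the normalizing factor of e_{a_N}. *)
Definition section_coef n N : R :=
  (\prod_(1 <= k < n.+1) (N + k)%N%:R) / (2 * pi) ^+ n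
  * multinomial R N (@half_exponent n N).

(** The tensor power contributes <w>^N, which cancels half of the denominator <w>^(2N). *)
Lemma tensor_norm_basis_section n N (w : Cspace R n.+1) :
  tensor_norm (basis_section N (@half_exponent n.+1 N) w) =
  Num.sqrt (section_coef n.+1 N)
  * Num.sqrt (sqr_norm (tnth w ord0)) ^+ N./2 / bracket w ^+ N.
Proof.
have coordE : \prod_(j < n.+1) chart_coord w j ^+ half_exponent N j =
    chart_coord w ord0 ^+ N./2.
  by rewrite big_ord_recl big1 ?mulr1.
rewrite /basis_section coordE tensor_normZ tensor_norm_power sum_normc_wtilde.
rewrite !normcM normcV normcX normc_chart_coord !normc_real.
rewrite !ger0_norm ?sqrtr_ge0//; last first.
  by rewrite exprn_ge0// ltW// bracket_gt0.
rewrite -/(section_coef n.+1 N) mul2n -addnn exprD; field.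
by rewrite gt_eqF// exprn_gt0// bracket_gt0.
Qed.

End pointwise_norm.

(** * The q-th power of the norm as a beta integral *)

Section section_integral.
Context {R : realType}.
Local Notation mu := (@lebesgue_measure R).
Local Notation leb2 := (product_sigma_finite mu mu).

Lemma sqrtX_powR (x q : R) k : 0 <= x ->
  (Num.sqrt x ^+ k) `^ q = x `^ (k%:R * (q / 2)).
Proof.
move=> x0; rewrite -powR_mulrn ?sqrtr_ge0// -powR12_sqrt// -!powRrM.
by congr powR; ring.
Qed.

Lemma section_coef_ge0 n N : 0 <= @section_coef R n N.
Proof.
rewrite mulr_ge0// ?divr_ge0 ?exprn_ge0 ?mulr_ge0 ?pi_ge0//.
by rewrite prodr_ge0.
Qed.

Lemma ge0_integral_fubini_study n (f : Cspace R n -> \bar R) :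
  measurable_fun setT f -> (forall w, (0 <= f w)%E) ->
  (\int[@fubini_study R n]_w f w =
   \int[lebesgue_Cspace R n]_w (f w * (fubini_study_density w)%:E))%E.
Proof.
move=> mf f0; apply: ge0_integral_density => //.
- exact: measurable_fubini_study_density.
- exact: fubini_study_density_ge0.
Qed.

(** In dimension n + 1, <w>^(-Nq) and the density factor <w>^(-2(n+2)) merge into one power of 1 +
    |w|^2, as [integral_Cspace_powR] expects. *)
Lemma powR_tensor_norm_density n N (q : R) (w : Cspace R n.+1) :
  tensor_norm (basis_section N (@half_exponent n.+1 N) w) `^ q *
    fubini_study_density w =
  2 ^+ n.+1 * section_coef n.+1 N `^ (q / 2)
  * ((sqr_norm (tnth w ord0)) `^ (N./2%:R * (q / 2))
     * (1 + sqr_sum w) `^ (- (N%:R * (q / 2) + n.+2%:R))).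
Proof.
have S0 : 0 < 1 + sqr_sum w by rewrite ltr_pwDl// sqr_sum_ge0.
have s0 := sqr_norm_ge0 (tnth w ord0).
rewrite tensor_norm_basis_section /fubini_study_density.
have B0 : 0 <= bracket w := ltW (bracket_gt0 w).
rewrite powRM ?invr_ge0 ?mulr_ge0 ?exprn_ge0 ?sqrtr_ge0//.
rewrite powRM ?exprn_ge0 ?sqrtr_ge0//.
(* Seen as a first power, the square root of the coefficient also falls under [sqrtX_powR]. *)
rewrite -[X in X `^ q](expr1 (Num.sqrt (section_coef _ _))).
rewrite !sqrtX_powR ?section_coef_ge0// mul1r.
have -> : (bracket w ^+ N)^-1 `^ q = (1 + sqr_sum w) `^ (- (N%:R * (q / 2))).
  rewrite -powR_inv1 ?exprn_ge0 ?(ltW (bracket_gt0 _))// -powRrM mulN1r.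
  by rewrite !powRN bracketE sqrtX_powR// ltW.
have -> : (bracket w ^+ (2 * n.+2))^-1 = (1 + sqr_sum w) `^ (- n.+2%:R).
  by rewrite powR_invn ?ltW// bracketE exprM sqr_sqrtr ?ltW.
rewrite [in RHS]opprD (powRD (r := - (N%:R * (q / 2)))); last first.
  by rewrite (gt_eqF S0) implybT.
ring.
Qed.

Lemma measurable_sqr_norm_tnth n (j : 'I_n) :
  measurable_fun setT (fun w : Cspace R n => sqr_norm (tnth w j)).
Proof.
apply: (measurableT_comp measurable_sqr_norm); exact: measurable_tnth.
Qed.

Lemma measurable_tensor_norm_basis_section n N :
  measurable_fun setT
    (fun w => tensor_norm (@basis_section R n.+1 N (@half_exponent n.+1 N) w)).
Proof.
have msqrt := continuous_measurable_fun (@sqrt_continuous R).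
under eq_fun => w.
  rewrite tensor_norm_basis_section -powR_invn ?(ltW (bracket_gt0 _))// bracketE.
  over.
apply: measurable_funM.
  apply: measurable_funM => //; apply: measurable_funX.
  by apply: (measurableT_comp msqrt); exact: measurable_sqr_norm_tnth.
apply: (measurableT_comp (measurable_powR _)).
apply: (measurableT_comp msqrt).
by apply: measurable_funD => //; exact: measurable_sqr_sum.
Qed.

Lemma tensor_norm_ge0 n N (T : tensor R n N) : 0 <= tensor_norm T.
Proof. exact: sqrtr_ge0. Qed.

(** The last n coordinates are integrated with A = 1 + |z|^2, then the first coordinate z radially,
    then t = r / (1 + r) is substituted. The condition [1 < N] makes [N./2] positive, as
    [integral0y_beta] requires. *)
Lemma integral_powR_basis_section n N (q : R) : (1 < N)%N -> 0 < q ->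
  (\int[@fubini_study R n.+1]_w
    (tensor_norm (basis_section N (@half_exponent n.+1 N) w) `^ q)%:E =
  (2 ^+ n.+1 * section_coef n.+1 N `^ (q / 2) * unit_disc_area R ^+ n.+1 /
    \prod_(i < n) (N%:R * (q / 2) + (n.+2%:R - i.+1%:R)))%:E *
  \int[mu]_(t in `[0%R, 1%R]) (beta_weight q N t)%:E)%E.
Proof.
move=> N1 q0; have q20 : 0 < q / 2 by rewrite divr_gt0.
have Nq0 : 0 <= N%:R * (q / 2) by rewrite mulr_ge0// ltW.
have Npos : (0 < N./2)%N by rewrite half_gt0.
rewrite ge0_integral_fubini_study; last 2 first.
- apply/measurable_EFinP/(measurableT_comp (measurable_powR _)).
  exact: measurable_tensor_norm_basis_section.
- by move=> w; rewrite lee_fin powR_ge0.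
set M := N%:R * (q / 2) + n.+2%:R.
set c := 2 ^+ n.+1 * section_coef n.+1 N `^ (q / 2).
set a := N./2%:R * (q / 2).
have c0 : 0 <= c by rewrite mulr_ge0 ?exprn_ge0 ?powR_ge0.
pose f (w : Cspace R n.+1) := (sqr_norm (tnth w ord0) `^ a *
  (1 + sqr_sum w) `^ (- M))%:E.
have mf : measurable_fun setT f.
  apply/measurable_EFinP/measurable_funM;
    apply: (measurableT_comp (measurable_powR _)).
    exact: measurable_sqr_norm_tnth.
  by apply: measurable_funD => //; exact: measurable_sqr_sum.
have f0 w : (0 <= f w)%E by rewrite lee_fin mulr_ge0 ?powR_ge0.
transitivity (c%:E * \int[lebesgue_Cspace R n.+1]_w f w)%E.
  rewrite -ge0_integralZl//; apply: eq_integral => w _.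
  by rewrite -EFinM powR_tensor_norm_density EFinM.
rewrite ge0_integral_CspaceS// /f.
have inner (z : plane R) : (\int[lebesgue_Cspace R n]_w
    (sqr_norm (tnth (cons_pair (z, w)) ord0) `^ a
     * (1 + sqr_sum (cons_pair (z, w))) `^ (- M))%:E)%E =
  (sqr_norm z `^ a * (unit_disc_area R ^+ n * (1 + sqr_norm z) `^ (n%:R - M)
    / \prod_(i < n) (M - i.+1%:R)))%:E.
  have z0 : 0 < 1 + sqr_norm z by rewrite ltr_pwDl// sqr_norm_ge0.
  have nM : n%:R < M by rewrite ltr_wpDl// ltr_nat.
  rewrite EFinM -integral_Cspace_powR// -ge0_integralZl//.
  - by apply: eq_integral => w _; rewrite sqr_sum_cons addrA EFinM.
  - apply/measurable_EFinP/(measurableT_comp (measurable_powR _)).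
    by apply: measurable_funD => //; exact: measurable_sqr_sum.
  - by move=> w _; rewrite lee_fin powR_ge0.
  - by rewrite lee_fin powR_ge0.
under eq_integral do rewrite inner.
set P := \prod_(i < n) _.
have P0 : 0 <= P.
  apply: prodr_ge0 => i _; rewrite subr_ge0 ler_wpDl// ler_nat.
  by rewrite (leq_trans (ltn_ord i))// -addn2 leq_addr.
have -> : \prod_(i < n) (N%:R * (q / 2) + (n.+2%:R - i.+1%:R)) = P.
  by apply: eq_bigr => i _; rewrite addrA.
pose d := unit_disc_area R ^+ n / P.
have d0 : 0 <= d by rewrite divr_ge0// exprn_ge0// ltW// unit_disc_area_gt0.
pose g (r : R) := (d%:E * (r `^ a * (1 + r) `^ (n%:R - M))%:E)%E.
rewrite (eq_integral (g \o sqr_norm)); last first.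
  by move=> z _; rewrite /g/= -!EFinM /d; congr EFin; ring.
have mg : measurable_fun setT (fun r : R => (r `^ a * (1 + r) `^ (n%:R - M))%:E).
  apply/measurable_EFinP/measurable_funM; first exact: measurable_powR.
  by apply: (measurableT_comp (measurable_powR _)); exact: measurable_funD.
rewrite ge0_integral_radial; last 2 first.
- exact: measurable_funeM.
- by move=> r; rewrite mule_ge0// lee_fin// mulr_ge0 ?powR_ge0.
rewrite /g ge0_integralZl//; last 2 first.
- exact: measurable_funTS.
- by move=> r _; rewrite lee_fin mulr_ge0 ?powR_ge0.
(* M - n = Nq/2 + 2, and Nq/2 is the sum of the two beta exponents. *)
rewrite (_ : n%:R - M = - (a + (N - N./2)%:R * (q / 2) + 2)); last first.
  rewrite /M /a natr_uphalf -[n.+2]addn2 natrD [in LHS](natr_half N); ring.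
rewrite integral0y_beta ?mulr_gt0 ?ltr0n// !muleA -!EFinM; congr (_ * _)%E.
by congr EFin; rewrite /d exprS; ring.
Qed.

End section_integral.

(** * Asymptotics *)

Section coefficient_asymptotics.
Context {R : realType}.
Local Notation mu := (@lebesgue_measure R).

Lemma multinomial_half n N :
  multinomial R N (@half_exponent n.+1 N) =
  N`!%:R / (N./2`!%:R * (N - N./2)`!%:R).
Proof.
rewrite /multinomial !big_ord_recl /= !big1 ?muln1 ?addn0//.
Qed.

(** At q = 2 the exponents are the integers k and N - k, so this is Euler's beta integral with
    parameters k + 1 and N - k + 1. *)
Lemma integral_beta_weight2 N :
  (\int[mu]_(t in `[0%R, 1%R]) (beta_weight 2 N t)%:E =
   (N./2`!%:R * (N - N./2)`!%:R / N.+1`!%:R)%:E)%E.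
Proof.
have kN : (N./2 + (N - N./2) = N)%N.
  by rewrite subnKC// -{2}(odd_double_half N) -addnn addnA leq_addl.
transitivity (beta_fun N./2.+1 (N - N./2).+1 : R)%:E.
  rewrite EFin_beta_fun [LHS]integral_mkcond; apply: eq_integral => t _ /=.
  rewrite !patchE; case: ifPn => // /set_mem; rewrite /= in_itv/= => /andP[t0 t1].
  by rewrite /beta_weight /XMonemX divff ?pnatr_eq0// !mulr1 !powR_mulrn// subr_ge0.
by rewrite beta_fun_fact natrM kN.
Qed.

(* For q = 2 the integral of [beta_weight] is k! (N - k)! / (N + 1)!, so Laplace's
   method also gives the asymptotics of the central binomial coefficient. *)
Lemma cvg_central_multinomial :
  N`!%:R / (N./2`!%:R * (N - N./2)`!%:R) * Num.sqrt N%:R / 2 ^+ N @[N --> \oo]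
    --> (2 / Num.sqrt (pi / (2 / 4)) : R).
Proof.
have /fine_cvgP[_ Jcvg] := @cvg_integral_laplace_fun R 2 (lexx _).
have c0 : Num.sqrt (pi / (2 / 4) : R) != 0.
  by rewrite gt_eqF// sqrtr_gt0 divr_gt0// ?pi_gt0.
(* The factor 1 - 1/(N + 1) = N/(N + 1) turns (N + 1)! into N N!, and N / sqrt N is the sqrt N of
   the claim. *)
have lim : 2 * (1 - N.+1%:R^-1) / fine (\int[mu]_y (laplace_fun 2 N y)%:E)
    @[N --> \oo] --> (2 * (1 - 0) / Num.sqrt (pi / (2 / 4)) : R).
  apply: cvgM; last exact: cvgV Jcvg.
  apply: cvgM; first exact: cvg_cst.
  apply: cvgB; [exact: cvg_cst|exact: cvg_harmonic].
rewrite subr0 mulr1 in lim; apply: cvg_trans lim; apply: near_eq_cvg.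
near=> N; have N0 : (0 < N)%N by near: N; exact: nbhs_infty_gt.
rewrite -integral_laplace_fun// integral_beta_weight2 -EFinM/= divff// mulr1.
have s0 : Num.sqrt (N%:R : R) != 0 by rewrite gt_eqF// sqrtr_gt0 ltr0n.
have f0 k : k`!%:R != 0 :> R by rewrite pnatr_eq0 -lt0n fact_gt0.
have sE : Num.sqrt N%:R = N%:R / Num.sqrt N%:R :> R.
  by rewrite -[X in X / _](sqr_sqrtr (ler0n R N)) expr2 mulfK.
rewrite [X in _ = _ * X / _]sE powR_mulrn// factS natrM.
have N10 : N.+1%:R != 0 :> R by rewrite pnatr_eq0.
rewrite -natr1 in N10 *.
field.
by rewrite N10 s0 !f0 expf_neq0.
Unshelve. all: by end_near. Qed.

Lemma cvg_prod_affine (n : nat) (al : R) (c : nat -> R) :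
  (\prod_(i < n) (al * N%:R + c i)) / N%:R ^+ n @[N --> \oo] --> al ^+ n.
Proof.
elim: n => [|n ih].
  under eq_fun do rewrite big_ord0 expr0 divr1.
  by rewrite expr0; exact: cvg_cst.
have lim : ((\prod_(i < n) (al * N%:R + c i)) / N%:R ^+ n) * (al + c n / N%:R)
    @[N --> \oo] --> al ^+ n * (al + c n * 0).
  apply: cvgM => //; apply: cvgD; first exact: cvg_cst.
  by apply: cvgMr; exact: cvg_natV.
rewrite exprSr; rewrite mulr0 addr0 in lim; apply: cvg_trans lim.
apply: near_eq_cvg; near=> N.
have N0 : N%:R != 0 :> R.
  by rewrite gt_eqF// ltr0n; near: N; exact: nbhs_infty_gt.
rewrite big_ord_recr/= exprSr; field.
by rewrite N0 expf_neq0.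
Unshelve. all: by end_near. Qed.

(** The limit for dimension n + 1, in the form delivered by Laplace's method at q = 2; pi / (2/4) is
    2 pi. *)
Definition coef_limit n : R :=
  2 / Num.sqrt (pi / (2 / 4)) / (2 * pi) ^+ n.+1.

Lemma coef_limit_gt0 n : 0 < coef_limit n.
Proof.
by rewrite !divr_gt0 ?exprn_gt0 ?mulr_gt0 ?sqrtr_gt0 ?divr_gt0 ?pi_gt0.
Qed.

(** The n + 1 linear factors give N^(n+1), and the central binomial coefficient gives 2^N / sqrt
    N. *)
Lemma cvg_section_coef n :
  section_coef n.+1 N / (N%:R `^ (n.+1%:R - 2^-1) * 2 ^+ N) @[N --> \oo]
  --> coef_limit n.
Proof.
have lim : (\prod_(i < n.+1) (1 * N%:R + i.+1%:R)) / N%:R ^+ n.+1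
   * (N`!%:R / (N./2`!%:R * (N - N./2)`!%:R) * Num.sqrt N%:R / 2 ^+ N)
   / (2 * pi) ^+ n.+1 @[N --> \oo]
   --> (1 ^+ n.+1 * (2 / Num.sqrt (pi / (2 / 4))) / (2 * pi) ^+ n.+1 : R).
  apply: cvgM; last exact: cvg_cst.
  apply: cvgM; last exact: cvg_central_multinomial.
  have := @cvg_prod_affine n.+1 1 (fun i => i.+1%:R); apply.
rewrite expr1n mul1r in lim; apply: cvg_trans lim; apply: near_eq_cvg.
near=> N; have N0 : 0 < N%:R :> R.
  by rewrite ltr0n; near: N; exact: nbhs_infty_gt.
rewrite /section_coef multinomial_half big_add1 big_mkord.
have -> : \prod_(i < n.+1) (N + i.+1)%:R =
    \prod_(i < n.+1) (1 * N%:R + i.+1%:R) :> R.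
  by apply: eq_bigr => i _; rewrite natrD mul1r.
rewrite powRB; last by rewrite (gt_eqF N0) implybT.
rewrite powR_mulrn ?ltW// powR12_sqrt ?ltW//.
field.
have f0 k : k`!%:R != 0 :> R by rewrite pnatr_eq0 -lt0n fact_gt0.
rewrite !f0 !expf_neq0 ?mulf_neq0 ?(gt_eqF N0) ?(gt_eqF (pi_gt0 R))//.
by rewrite gt_eqF// sqrtr_gt0.
Unshelve. all: by end_near. Qed.

End coefficient_asymptotics.

(** * Norms for finite exponents *)

Section Lp_asymptotics.
Context {R : realType}.
Local Notation mu := (@lebesgue_measure R).

Lemma fine_Lp_norm n N (q : R) :
  fine (Lp_norm q%:E (@basis_section R n.+1 N (@half_exponent n.+1 N))) =
  fine (\int[@fubini_study R n.+1]_w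
    (tensor_norm (basis_section N (@half_exponent n.+1 N) w) `^ q)%:E)%E `^ q^-1.
Proof.
rewrite /Lp_norm/= unlock fine_poweR; congr (fine _ `^ _).
apply: eq_integral => w _.
by rewrite gee0_abs ?lee_fin ?tensor_norm_ge0// poweR_EFin.
Qed.

(** The square root is the Gaussian integral, the 2 below it comes from the Jacobian 1/(2 sqrt N),
    and (q/2)^n from the n linear factors produced by integrating out w_2, ..., w_{n+1}. *)
Definition Lp_constant n (q : R) : R :=
  (2 ^+ n.+1 * unit_disc_area R ^+ n.+1 * coef_limit n `^ (q / 2)
   * Num.sqrt (pi / (q / 4)) / (2 * (q / 2) ^+ n)) `^ q^-1.

(** With T = N^(n + 1/2), the integral is Y_N T^(q/2) / T for a convergent Y_N: c_N^(q/2) brings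
    T^(q/2), the integration brings 1/T, and the powers of 2 cancel. The q-th root leaves T^(1/2 -
    1/q). *)
Lemma cvg_fine_Lp_norm n (q : R) : 2 <= q ->
  fine (Lp_norm q%:E (@basis_section R n.+1 N (@half_exponent n.+1 N)))
    / N%:R `^ ((n.+1%:R - 2^-1) * (2^-1 - q^-1)) @[N --> \oo]
  --> Lp_constant n q.
Proof.
move=> q2; have q0 : 0 < q by rewrite (lt_le_trans _ q2).
have qn0 : q != 0 by rewrite gt_eqF.
have [Jfin Jcvg] := (fine_cvgP _ _).1 (cvg_integral_laplace_fun q2).
pose Cn N : R := section_coef n.+1 N / (N%:R `^ (n.+1%:R - 2^-1) * 2 ^+ N).
pose p N : R := \prod_(i < n) (q / 2 * N%:R + (n.+2%:R - i.+1%:R)) / N%:R ^+ n.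
pose J N : R := fine (\int[mu]_y (laplace_fun q N y)%:E)%E.
pose Y N : R := 2 ^+ n.+1 * unit_disc_area R ^+ n.+1 * Cn N `^ (q / 2) * J N
  / (2 * p N).
have Ypos : 0 < 2 ^+ n.+1 * unit_disc_area R ^+ n.+1 * coef_limit n `^ (q / 2)
   * Num.sqrt (pi / (q / 4)) / (2 * (q / 2) ^+ n).
  by rewrite !(divr_gt0, mulr_gt0, exprn_gt0, powR_gt0, sqrtr_gt0,
     coef_limit_gt0, unit_disc_area_gt0, pi_gt0).
have limY : Y N `^ q^-1 @[N --> \oo] --> Lp_constant n q.
  apply: (@continuous_cvg _ _ _ _ _ _ (@powR R ^~ q^-1)).
    exact: powR_continuous_at.
  apply: cvgM; last first.
    apply: cvgV; first by rewrite gt_eqF// mulr_gt0// exprn_gt0// divr_gt0.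
    apply: cvgM; first exact: cvg_cst.
    exact: (@cvg_prod_affine R n (q / 2) (fun i => n.+2%:R - i.+1%:R)).
  apply: cvgM => //; apply: cvgM; first exact: cvg_cst.
  apply: (@continuous_cvg _ _ _ _ _ _ (@powR R ^~ (q / 2))).
    by apply: powR_continuous_at; exact: coef_limit_gt0.
  exact: cvg_section_coef.
apply: cvg_trans limY; apply: near_eq_cvg; near=> N.
have N1 : (1 < N)%N by near: N; exact: nbhs_infty_gt.
have N0 : 0 < N%:R :> R by rewrite ltr0n ltnW.
have JN : (\int[mu]_y (laplace_fun q N y)%:E)%E = (J N)%:E.
  by rewrite fineK//; near: N; exact: Jfin.
set T : R := N%:R `^ (n.+1%:R - 2^-1).
have T0 : 0 < T by rewrite powR_gt0.
(* The power governing c_N is also the decay of the integral: N^n from the product, sqrt N from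
   Laplace's method. *)
have TE : T = N%:R ^+ n * Num.sqrt N%:R.
  rewrite /T (_ : n.+1%:R - 2^-1 = n%:R + 2^-1); last by rewrite -natr1; field.
  rewrite powRD; last by rewrite (gt_eqF N0) implybT.
  by rewrite powR_mulrn ?ltW// powR12_sqrt ?ltW.
have s0 : 0 < Num.sqrt (N%:R : R) by rewrite sqrtr_gt0.
have D0 : 0 < 2 * Num.sqrt N%:R * 2 `^ (N%:R * (q / 2)).
  by rewrite !mulr_gt0// powR_gt0.
have BN : (\int[mu]_(t in `[0%R, 1%R]) (beta_weight q N t)%:E =
    (J N / (2 * Num.sqrt N%:R * 2 `^ (N%:R * (q / 2))))%:E)%E.
  have := @integral_laplace_fun R q N (ltnW N1); rewrite JN => JE.
  rewrite mulrC EFinM -JE muleA -EFinM mulVf ?mul1e// gt_eqF//.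
rewrite fine_Lp_norm integral_powR_basis_section// BN -EFinM.
have fineE (x : R) : fine x%:E = x by [].
rewrite fineE.
have cE : section_coef n.+1 N `^ (q / 2) =
    Cn N `^ (q / 2) * T `^ (q / 2) * 2 `^ (N%:R * (q / 2)).
  rewrite -[section_coef _ _](@divfK _ (T * 2 ^+ N)); last first.
    by rewrite gt_eqF// mulr_gt0// exprn_gt0.
  rewrite -/(Cn N) powRM//; last 2 first.
  - by rewrite divr_ge0 ?section_coef_ge0// mulr_ge0// ltW.
  - by rewrite mulr_ge0// ltW.
  by rewrite powRM ?(ltW T0)// -[2 ^+ N]powR_mulrn// -[in LHS]powRrM mulrA.
have pE : \prod_(i < n) (N%:R * (q / 2) + (n.+2%:R - i.+1%:R)) = p N * N%:R ^+ n.
  rewrite divfK; last by rewrite gt_eqF// exprn_gt0.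
  by apply: eq_bigr => i _; rewrite [N%:R * _]mulrC.
have pN0 : 0 < p N.
  rewrite divr_gt0 ?exprn_gt0//; apply: prodr_gt0 => i _.
  rewrite ltr_pwDl ?mulr_gt0 ?divr_gt0// subr_ge0 ler_nat.
  by rewrite (leq_trans (ltn_ord i))// -addn2 leq_addr.
have Y0 : 0 <= Y N.
  apply: divr_ge0; last by rewrite mulr_ge0// ltW.
  apply: mulr_ge0.
    by rewrite !mulr_ge0 ?exprn_ge0 ?powR_ge0// ltW// unit_disc_area_gt0.
  by apply: fine_ge0; apply: integral_ge0 => y _; rewrite lee_fin laplace_fun_ge0.
have XE : 2 ^+ n.+1 * section_coef n.+1 N `^ (q / 2) * unit_disc_area R ^+ n.+1 /
    \prod_(i < n) (N%:R * (q / 2) + (n.+2%:R - i.+1%:R)) *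
    (J N / (2 * Num.sqrt N%:R * 2 `^ (N%:R * (q / 2)))) =
    Y N * T `^ (q / 2 - 1).
  have -> : T `^ (q / 2 - 1) = T `^ (q / 2) / (N%:R ^+ n * Num.sqrt N%:R).
    by rewrite -TE powRB ?powRr1 ?(ltW T0)// (gt_eqF T0) implybT.
  rewrite cE pE /Y; field.
  by rewrite !gt_eqF ?exprn_gt0 ?powR_gt0.
rewrite XE powRM ?powR_ge0// /T -!powRrM.
have -> : (n.+1%:R - 2^-1) * ((q / 2 - 1) / q) = (n.+1%:R - 2^-1) * (2^-1 - q^-1).
  by field.
by rewrite mulfK// gt_eqF// powR_gt0.
Unshelve. all: by end_near. Qed.

End Lp_asymptotics.

(** * The supremum norm *)

Section sup_norm.
Context {R : realType}.

(** For y = (1 - s)/(1 + s) one has 1 - y^2 = 4s/(1 + s)^2 and 1 + y = 2/(1 + s), so 2^N times the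
    left side is (1 - y^2)^k times 1 or 1 + y according to the parity of N. By 1 + u <= e^u it
    remains to bound -k y^2 or -k y^2 + y by 1/(4k). *)
Lemma exprn_div_le_expR (s : R) N : 0 <= s -> (1 < N)%N ->
  s ^+ N./2 / (1 + s) ^+ N <= expR (4 * N./2%:R)^-1 / 2 ^+ N.
Proof.
move=> s0 N1; have s1 : 0 < 1 + s by rewrite ltr_pwDl.
have k0 : 0 < N./2%:R :> R by rewrite ltr0n half_gt0.
set y := (1 - s) / (1 + s).
have y1 : -1 <= y <= 1.
  rewrite ler_pdivlMr// ler_pdivrMr//; lra.
rewrite ler_pdivlMr ?exprn_gt0//.
have -> : s ^+ N./2 / (1 + s) ^+ N * 2 ^+ N =
    (1 - y ^+ 2) ^+ N./2 * (1 + y) ^+ odd N.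
  have -> : 1 - y ^+ 2 = 4 * s / (1 + s) ^+ 2 by rewrite /y; field; rewrite gt_eqF.
  have -> : 1 + y = 2 / (1 + s) by rewrite /y; field; rewrite gt_eqF.
  have pw (x : R) : x ^+ N = (x ^+ 2) ^+ N./2 * x ^+ odd N.
    by rewrite -exprM mul2n -exprD addnC odd_double_half.
  have -> : 4 = 2 ^+ 2 :> R by rewrite expr2 -natrM.
  rewrite !pw !expr2 !exprMn !exprVn !exprMn.
  by field; rewrite !expf_neq0// gt_eqF.
apply: (@le_trans _ _ (expR (- y ^+ 2) ^+ N./2 * expR y ^+ odd N)).
  apply: ler_pM.
  - by rewrite exprn_ge0// subr_ge0; move: y1; nra.
  - by rewrite exprn_ge0//; move: y1; lra.
  - apply: lerXn2r; rewrite ?nnegrE ?expR_ge0//.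
      by rewrite subr_ge0; move: y1; nra.
    exact: expR_ge1Dx.
  - apply: lerXn2r; rewrite ?nnegrE ?expR_ge0//.
      by move: y1; lra.
    exact: expR_ge1Dx.
rewrite -!expRM_natl -expRD ler_expR.
rewrite -[leRHS]mul1r ler_pdivlMr ?mulr_gt0//.
(* This square settles odd N by giving 4k(y - k y^2) <= 1; the next one settles even N. *)
have : 0 <= (2 * N./2%:R * y - 1) ^+ 2 by exact: sqr_ge0.
have : 0 <= (N./2%:R * y) ^+ 2 by exact: sqr_ge0.
by case: (odd N) => /=; nra.
Qed.

(** For even N = 2k the pointwise norm peaks here, since r^k/(1 + r)^(2k) is largest at r = 1. *)
Definition unit_point n : Cspace R n.+1 :=
  [tuple (if i == ord0 then (1, 0) else (0, 0)) : plane R | i < n.+1].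

Lemma sqr_norm_unit_point n : sqr_norm (tnth (unit_point n) ord0) = 1.
Proof. by rewrite tnth_mktuple/= /sqr_norm/= expr1n expr0n addr0. Qed.

Lemma sqr_sum_unit_point n : sqr_sum (unit_point n) = 1.
Proof.
rewrite /sqr_sum big_ord_recl sqr_norm_unit_point big1 ?addr0// => i _.
by rewrite tnth_mktuple/= /sqr_norm/= expr0n addr0.
Qed.

Definition section_norm n N (w : Cspace R n.+1) :=
  tensor_norm (basis_section N (@half_exponent n.+1 N) w).

Lemma section_norm_unit_point n N :
  section_norm N (unit_point n) = Num.sqrt (section_coef n.+1 N / 2 ^+ N).
Proof.
rewrite /section_norm tensor_norm_basis_section bracketE.
rewrite sqr_norm_unit_point sqr_sum_unit_point sqrtr1 expr1n mulr1.
rewrite [in RHS]sqrtrM ?section_coef_ge0// sqrtrV ?exprn_ge0//; congr (_ / _).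
rewrite -[2 in RHS](sqr_sqrtr (ler0n R 2)) -exprM mulnC exprM sqrtr_sqr.
by rewrite ger0_norm// exprn_ge0.
Qed.

(** The squared norm is c_N s^k / (1 + |w|^2)^N with s = |w_1|^2; dropping the other coordinates
    from the denominator reduces it to one variable. *)
Lemma section_norm_le n N (w : Cspace R n.+1) : (1 < N)%N ->
  section_norm N w <= Num.sqrt (section_coef n.+1 N / 2 ^+ N)
    * Num.sqrt (expR (4 * N./2%:R)^-1).
Proof.
move=> N1; rewrite -sqrtrM; last by rewrite divr_ge0 ?section_coef_ge0// exprn_ge0.
rewrite -[leLHS]ger0_norm ?tensor_norm_ge0// -sqrtr_sqr; apply: ler_wsqrtr.
have s0 := sqr_norm_ge0 (tnth w ord0); have S0 := sqr_sum_ge0 w.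
rewrite /section_norm tensor_norm_basis_section bracketE exprMn exprVn !exprMn.
rewrite -!exprM ![(_ * 2)%N]mulnC !exprM !sqr_sqrtr ?section_coef_ge0//; last first.
  by rewrite addr_ge0.
move: (@section_coef R n.+1 N) (@section_coef_ge0 R n.+1 N) => c c0.
rewrite -!mulrA; apply: ler_wpM2l => //.
rewrite [leRHS]mulrC; apply: le_trans (exprn_div_le_expR s0 N1).
apply: ler_wpM2l; first exact: exprn_ge0.
rewrite lef_pV2 ?posrE ?exprn_gt0 ?ltr_pwDl//.
apply: lerXn2r; [by rewrite nnegrE addr_ge0|by rewrite nnegrE addr_ge0|].
rewrite lerD2l.
rewrite /sqr_sum big_ord_recl lerDl; apply: sumr_ge0 => i _; exact: sqr_norm_ge0.
Qed.

Lemma fine_sup_norm_bounds n N : (1 < N)%N ->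
  Num.sqrt (section_coef n.+1 N / 2 ^+ N) <=
  fine (Lp_norm +oo (@basis_section R n.+1 N (@half_exponent n.+1 N))) <=
  Num.sqrt (section_coef n.+1 N / 2 ^+ N) * Num.sqrt (expR (4 * N./2%:R)^-1).
Proof.
move=> N1; rewrite /Lp_norm eqxx.
set S := ereal_sup _.
have Sle : (S <= (Num.sqrt (section_coef n.+1 N / 2 ^+ N)
    * Num.sqrt (expR (4 * N./2%:R)^-1))%:E)%E.
  by apply: ge_ereal_sup => _ [w _ <-]; rewrite lee_fin; exact: section_norm_le.
have Sge : ((Num.sqrt (section_coef n.+1 N / 2 ^+ N))%:E <= S)%E.
  rewrite -section_norm_unit_point; apply: ereal_sup_ubound.
  by exists (unit_point n).
have Sfin : S \is a fin_num.
  rewrite fin_numElt (lt_le_trans _ Sge) ?ltNyr//.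
  by rewrite (le_lt_trans Sle) ?ltry.
by rewrite -!lee_fin fineK// Sge Sle.
Qed.

(** After division by the power of N, both bounds of [fine_sup_norm_bounds] have the same limit, as
    1/(4k) tends to 0. *)
Lemma cvg_fine_sup_norm n :
  fine (Lp_norm +oo (@basis_section R n.+1 N (@half_exponent n.+1 N)))
    / N%:R `^ ((n.+1%:R - 2^-1) * 2^-1) @[N --> \oo]
  --> Num.sqrt (@coef_limit R n).
Proof.
pose Cn N : R := section_coef n.+1 N / (N%:R `^ (n.+1%:R - 2^-1) * 2 ^+ N).
have limC : Num.sqrt (Cn N) @[N --> \oo] --> Num.sqrt (@coef_limit R n).
  by apply: continuous_cvg; [exact: sqrt_continuous|exact: cvg_section_coef].
have limE : Num.sqrt (expR (4 * N./2%:R)^-1) @[N --> \oo] --> (1 : R).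
  have e1 : Num.sqrt (expR 0) = 1 :> R by rewrite expR0 sqrtr1.
  rewrite -[X in _ --> X]e1.
  apply: continuous_cvg; first exact: sqrt_continuous.
  apply: continuous_cvg; first exact: continuous_expR.
  have lim : 4^-1 * ((N./2%:R / N%:R)^-1 * N%:R^-1) @[N --> \oo]
      --> (4^-1 * ((2^-1)^-1 * 0) : R).
    apply: cvgMr; apply: cvgM; last exact: cvg_natV.
    by apply: cvgV; [rewrite invr_eq0 pnatr_eq0|exact: cvg_half_ratio].
  rewrite !mulr0 in lim; apply: cvg_trans lim; apply: near_eq_cvg.
  near=> N; rewrite !invfM invrK mulfK//.
  by rewrite gt_eqF// ltr0n; near: N; exact: nbhs_infty_gt.
have CE N : (1 < N)%N -> Num.sqrt (Cn N) =
    Num.sqrt (section_coef n.+1 N / 2 ^+ N) / N%:R `^ ((n.+1%:R - 2^-1) * 2^-1).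
  move=> N1; rewrite powRrM powR12_sqrt ?powR_ge0// -sqrtrV ?powR_ge0// -sqrtrM.
    by rewrite /Cn; congr Num.sqrt; rewrite invfM; ring.
  by rewrite divr_ge0 ?section_coef_ge0// exprn_ge0.
apply: (@squeeze_cvgr _ _ _ _ (fun N => Num.sqrt (Cn N))
  (fun N => Num.sqrt (Cn N) * Num.sqrt (expR (4 * N./2%:R)^-1))) => //; last first.
  by rewrite -[X in _ --> X]mulr1; apply: cvgM.
near=> N; have N1 : (1 < N)%N by near: N; exact: nbhs_infty_gt.
have T0 : 0 < N%:R `^ ((n.+1%:R - 2^-1) * 2^-1) :> R.
  by rewrite powR_gt0// ltr0n ltnW.
have /andP[h1 h2] := fine_sup_norm_bounds n N1.
rewrite CE//; apply/andP; split; first by rewrite ler_pM2r ?invr_gt0.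
by rewrite [leRHS]mulrAC ler_pM2r ?invr_gt0.
Unshelve. all: by end_near. Qed.

End sup_norm.

(** * Uniform control of the constants and conclusion *)

Lemma Lp_constant_gt0 (R : realType) n (q : R) : 0 < q -> 0 < Lp_constant n q.
Proof.
move=> q0; rewrite powR_gt0// !(divr_gt0, mulr_gt0, exprn_gt0, powR_gt0,
  sqrtr_gt0, coef_limit_gt0, unit_disc_area_gt0, pi_gt0)//.
Qed.

(** The q-th root turns the power q/2 of [coef_limit] into its square root, whatever q is; the
    remaining factor Z is at most D times its Gaussian term at q = 2. *)
Lemma Lp_constant_le (R : realType) n (q : R) : 2 <= q ->
  Lp_constant n q <= Num.sqrt (coef_limit n) *
    (1 + 2 ^+ n.+1 * unit_disc_area R ^+ n.+1 * Num.sqrt (pi / (2 / 4))).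
Proof.
move=> q2; have q0 : 0 < q by rewrite (lt_le_trans _ q2).
have g0 := @coef_limit_gt0 R n; have k0 := @unit_disc_area_gt0 R.
set D := 2 ^+ n.+1 * unit_disc_area R ^+ n.+1.
have D0 : 0 < D by rewrite mulr_gt0 ?exprn_gt0.
set Z := D * Num.sqrt (pi / (q / 4)) / (2 * (q / 2) ^+ n).
have Z0 : 0 <= Z.
  apply: divr_ge0; first by rewrite mulr_ge0// ltW.
  by rewrite mulr_ge0// exprn_ge0// divr_ge0// ltW.
have ZD : Z <= D * Num.sqrt (pi / (2 / 4)).
  have den1 : 1 <= 2 * (q / 2) ^+ n.
    have : 1 <= (q / 2) ^+ n by rewrite exprn_ege1// ler_pdivlMr// mul1r.
    lra.
  rewrite ler_pdivrMr ?(lt_le_trans ltr01)//.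
  apply: (@le_trans _ _ (D * Num.sqrt (pi / (2 / 4)))); last first.
    by rewrite ler_peMr// mulr_ge0// ltW.
  rewrite ler_pM2l//; apply: ler_wsqrtr.
  by rewrite ler_pM2l ?pi_gt0// lef_pV2 ?posrE ?divr_gt0//; lra.
rewrite /Lp_constant -/D.
have -> : D * coef_limit n `^ (q / 2) * Num.sqrt (pi / (q / 4)) /
    (2 * (q / 2) ^+ n) = coef_limit n `^ (q / 2) * Z by rewrite /Z; ring.
rewrite powRM ?powR_ge0// -powRrM (_ : q / 2 / q = 2^-1); last first.
  by field; rewrite gt_eqF.
rewrite powR12_sqrt ?(ltW g0)//; apply: ler_wpM2l => //.
(* Adding 1 makes the base at least 1, so that an exponent 1/q <= 1 cannot increase it. *)
apply: (@le_trans _ _ ((1 + D * Num.sqrt (pi / (2 / 4))) `^ q^-1)).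
  apply: ge0_ler_powR; rewrite ?nnegrE//; first by rewrite invr_ge0 ltW.
    by rewrite addr_ge0// mulr_ge0// ltW.
  by rewrite (le_trans ZD)// lerDr.
apply: ler1_powR.
  by rewrite lerDl mulr_ge0// ltW.
by rewrite invf_le1//; lra.
Qed.

Theorem theorem4p9 (R : realType) (n : nat) (hn : (1 <= n)%N) :
  exists C : \bar R -> R,
    [/\ forall p : \bar R, (2%:E <= p)%E -> 0 < C p,
        exists M : R, forall p : \bar R, (2%:E <= p)%E -> C p <= M
      & forall p : \bar R, (2%:E <= p)%E ->
          (fun N : nat =>
             fine (Lp_norm p (@basis_section R n N (half_exponent N)))
             / (C p * N%:R `^ ((n%:R - 2^-1) * (2^-1 - fine (p^-1)%E))))
            @ \oo --> (1 : R)].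
Proof.
case: n hn => // n _.
(* The second branch serves p = +oo; it also covers -oo, which 2 <= p excludes. *)
exists (fun p => if p is q%:E then Lp_constant n q else Num.sqrt (coef_limit n)).
have normalize (u v : nat -> R) (c : R) : 0 < c ->
    u N / v N @[N --> \oo] --> c -> u N / (c * v N) @[N --> \oo] --> (1 : R).
  move=> c0 uvc; have -> : (fun N => u N / (c * v N)) = (fun N => u N / v N / c).
    by apply/funext => N; rewrite invfM mulrA mulrAC.
  by rewrite -(@divff _ c) ?gt_eqF//; apply: cvgMl.
split.
- move=> [q||]//; last by rewrite sqrtr_gt0 coef_limit_gt0.
  by rewrite lee_fin => q2; apply: Lp_constant_gt0; exact: lt_le_trans q2.
- exists (Num.sqrt (coef_limit n) *
    (1 + 2 ^+ n.+1 * unit_disc_area R ^+ n.+1 * Num.sqrt (pi / (2 / 4)))).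
  move=> [q||]//; first by rewrite lee_fin; exact: Lp_constant_le.
  move=> _; rewrite ler_peMr// lerDl !mulr_ge0// exprn_ge0//.
  by rewrite ltW// unit_disc_area_gt0.
move=> [q||]//.
  rewrite lee_fin => q2; have q0 : 0 < q by exact: lt_le_trans q2.
  rewrite inver (gt_eqF q0)/=; apply: normalize; first exact: Lp_constant_gt0.
  exact: cvg_fine_Lp_norm.
move=> _; rewrite invey/= subr0; apply: normalize.
  by rewrite sqrtr_gt0 coef_limit_gt0.
exact: cvg_fine_sup_norm.
Qed.
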